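(* Let $\theta_{n+1}=\theta_n-\alpha_n(\nabla f(\theta_n)+w_n)$, $n\ge 0$, be the stochastic gradient recursion described in the context, and let $\Lambda=\{\sup_{n\ge 0}\|\theta_n\|<\infty\}$. Suppose that: (i) $\lim_{n\to\infty}\alpha_n=0$ and $\sum_{n=0}^\infty\alpha_n=\infty$; (ii) there exists a real number $r\in(0,\infty)$ such that $w=\limsup_{n\to\infty}\max_{n\le k<a(n,1)}\left\|\sum_{i=n}^k\alpha_i\gamma_i^r w_i\right\|<\infty$ w.p.1 on $\Lambda$; (iii) for any compact set $Q\subset\mathbb{R}^{d_\theta}$ and any $a\in f(Q)$, there exist real numbers $\delta_{Q,a}\in(0,1)$, $\mu_{Q,a}\in(1,2]$, $M_{Q,a}\in[1,\infty)$ such that $|f(\theta)-a|\le M_{Q,a}\|\nabla f(\theta)\|^{\mu_{Q,a}}$ for all $\theta\in Q$ satisfying $|f(\theta)-a|\le\delta_{Q,a}$; (iv) for any compact set $Q\subset\mathbb{R}^{d_\theta}$ there exist real numbers $\nu_Q\in(0,1]$, $N_Q\in[1,\infty)$ such that $d(\theta,S)\le N_Q\|\nabla f(\theta)\|^{\nu_Q}$ for all $\theta\in Q$. Then $$\|\nabla f(\theta_n)\|^2=o(\gamma_n^{-\hat p}),\quad d(f(\theta_n),C)=o(\gamma_n^{-\hat p}),\quad d(\theta_n,S)=o(\gamma_n^{-\hat q})$$ w.p.1 on $\Lambda\cap\{w=0,\ \hat r>r\}$, and $$\|\nabla f(\theta_n)\|^2=O(\gamma_n^{-\hat p}),\quad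 d(f(\theta_n),C)=O(\gamma_n^{-\hat p}),\quad d(\theta_n,S)=O(\gamma_n^{-\hat q})$$ w.p.1 on $\Lambda\cap\{w=0,\ \hat r>r\}^c$.
   Context: $f:\mathbb{R}^{d_\theta}\to\mathbb{R}$ is a differentiable function whose gradient $\nabla f$ is locally Lipschitz continuous. $\{\alpha_n\}_{n\ge 0}$ is a sequence of positive real numbers. On a probability space $(\Omega,\mathcal{F},P)$, $\theta_0$ is an $\mathbb{R}^{d_\theta}$-valued random variable and $\{w_n\}_{n\ge 0}$ is an $\mathbb{R}^{d_\theta}$-valued stochastic process (for each $n$, $w_n$ may be a random function of $\theta_0,\dots,\theta_n$). $\|\cdot\|$ is the Euclidean norm and $d(\cdot,\cdot)$ the induced distance. $S=\{\theta\in\mathbb{R}^{d_\theta}:\nabla f(\theta)=0\}$ and $C=\{f(\theta):\theta\in S\}$. $\gamma_0=0$ and $\gamma_n=\sum_{i=0}^{n-1}\alpha_i$ for $n\ge 1$. For $t\in(0,\infty)$, $n\ge 0$, $a(n,t)=\max\{k\ge n:\gamma_k-\gamma_n\le t\}$. ''W.p.1 on an event $A$'' means for all $\omega\in A$ outside a set of probability zero; $o,O$ are as $n\to\infty$ for each fixed $\omega$. $\hat A$ is the (random) set of accumulation points of $\{\theta_n\}_{n\ge0}$, $\hat f=\liminf_{n\to\infty}f(\theta_n)$, and $\hat Q=\{\theta:d(\theta,\hat A)\le\rho\}$ on $\Lambda$, $\hat Q=\hat A$ otherwise, where $\rho$ is an arbitrary positive (deterministic or random) quantity. With a fixed choice of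 the constants in (iii) and (iv), on $\Lambda$ set $\hat\mu=\mu_{\hat Q,\hat f}$, $\hat\nu=\mu_{\hat Q,\hat f}\,\nu_{\hat Q}/2$, and off $\Lambda$ set $\hat\mu=2$, $\hat\nu=1$. Further, $\hat r=1/(2-\hat\mu)$ if $\hat\mu<2$ and $\hat r=\infty$ if $\hat\mu=2$; $\hat p=\hat\mu\min\{r,\hat r\}$; $\hat q=\hat\nu\min\{r,\hat r\}$. *)

(* Defs.v *)
From mathcomp Require Export all_boot all_order all_algebra.
From mathcomp Require Export all_classical all_reals all_analysis.

Set Implicit Arguments.
Unset Strict Implicit.
Unset Printing Implicit Defensive.

Import Order.TTheory GRing.Theory Num.Theory.
Import numFieldNormedType.Exports.

Local Open Scope classical_set_scope.
Local Open Scope ring_scope.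

(* The library norm of 'rV[R]_d is the sup norm.  Every norm and distance below
   is Euclidean; the library structure is used only for the topology, the
   Borel sets and differentiability, which are the same for both norms. *)
Definition enorm (R : realType) (d : nat) (x : 'rV[R]_d) : R :=
  Num.sqrt (\sum_(i < d) x ord0 i ^+ 2).

(* Distance from x to A for the norm N, with value +oo when A is empty. *)
Definition setdist (R : realType) (U : zmodType) (N : U -> R) (A : set U)
    (x : U) : \bar R :=
  ereal_inf [set (N (x - y))%:E | y in A].

Definition grad (R : realType) (d : nat) (f : 'rV[R]_d -> R) (x : 'rV[R]_d) :
    'rV[R]_d :=
  \row_(i < d) 'D_(delta_mx ord0 i) f x.

Definition locally_lipschitz (R : realType) (d : nat)
    (g : 'rV[R]_d -> 'rV[R]_d) : Prop :=
  forall x : 'rV[R]_d, exists2 U, nbhs x U &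
    exists L : R, forall y z, U y -> U z ->
      enorm (g y - g z) <= L * enorm (y - z).

Definition random_vector (R : realType) (disp : measure_display)
    (Omega : measurableType disp) (d : nat) (X : Omega -> 'rV[R]_d) : Prop :=
  measurable_fun setT (X : Omega -> g_sigma_algebraType (@open 'rV[R]_d)).

Definition crit_points (R : realType) (d : nat) (f : 'rV[R]_d -> R) :
    set 'rV[R]_d :=
  [set x | grad f x = 0].

Definition crit_values (R : realType) (d : nat) (f : 'rV[R]_d -> R) : set R :=
  f @` crit_points f.

Definition gam (R : realType) (alpha : nat -> R) (n : nat) : R :=
  \sum_(0 <= i < n) alpha i.

(* max {k >= n : gam k - gam n <= t}; the default n is returned only if there
   is no maximum, which does not happen for t > 0, positive steps and a
   divergent sum of steps. *)
Definition aidx (R : realType) (alpha : nat -> R) (n : nat) (t : R) : nat :=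
  let K := [set k | (n <= k)%N /\ gam alpha k - gam alpha n <= t] in
  xget n [set k | K k /\ forall j, K j -> (j <= k)%N].

(* The maximum is 0 on an empty range of k, which occurs only while
   alpha n > 1, hence for finitely many n when alpha tends to 0. *)
Definition noise_limsup (R : realType) (d : nat) (alpha : nat -> R) (r : R)
    (v : nat -> 'rV[R]_d) : \bar R :=
  limn_esup (fun n =>
    (\big[Num.max/0]_(n <= k < aidx alpha n 1)
       enorm (\sum_(n <= i < k.+1) (alpha i * gam alpha i `^ r) *: v i))%:E).

Definition bounded_seq (R : realType) (d : nat) (x : nat -> 'rV[R]_d) : Prop :=
  (ereal_sup (range (fun n => (enorm (x n))%:E)) < +oo)%E.

Section random_exponents.
Context (R : realType) (d : nat) (f : 'rV[R]_d -> R).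
(* A single trajectory x = (theta_n(omega))_n and rho0 = rho(omega) > 0. *)
Context (x : nat -> 'rV[R]_d) (rho0 : R).
Context (mu : set 'rV[R]_d -> R -> R) (nu : set 'rV[R]_d -> R) (r : R).

(* Cluster points of the sequence (limits of subsequences), not limit points
   of its range. *)
Definition A_hat : set 'rV[R]_d := cluster (x @ \oo).

(* The liminf is finite for a bounded x, the only case in which f_hat is used. *)
Definition f_hat : R := fine (limn_einf (fun n => (f (x n))%:E)).

Definition Q_hat : set 'rV[R]_d :=
  if `[< bounded_seq x >]
  then [set y | (setdist (@enorm R d) A_hat y <= rho0%:E)%E]
  else A_hat.

Definition mu_hat : R :=
  if `[< bounded_seq x >] then mu Q_hat f_hat else 2.

Definition nu_hat : R :=
  if `[< bounded_seq x >] then mu Q_hat f_hat * nu Q_hat / 2 else 1.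

Definition r_hat : \bar R :=
  if mu_hat < 2 then ((2 - mu_hat)^-1)%:E else +oo%E.

Definition p_hat : R := mu_hat * fine (Order.min r%:E r_hat).

Definition q_hat : R := nu_hat * fine (Order.min r%:E r_hat).

End random_exponents.

(* Main.v *)
Require Import Defs.
From mathcomp Require Import ring lra.

(** The statement is pathwise: outside the null set where the noise bound fails,
one bounded trajectory [x] is followed, with [u n = f (x n) - fhat], where
[fhat] is the lower limit of [f] along [x].

Let a window be a stretch of indices over which the sum of the steps is about a
small constant [t]. Summation by parts turns the weighted noise bound into a
bound [b * gam n `^ (- r)] for the noise accumulated over a window
([noise_window_bound]). Since the gradient is Lipschitz on a ball that contains
the trajectory, the iterates of a window perform one gradient step of length
[t] up to that noise, so that
[u (next n) <= u n - G n + e n], with [G n] a multiple of the squared gradient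
and [e n] a multiple of the squared noise, hence [e n = O(gam n `^ (- 2 r))]
([window_descent_full]). Iterates inside the window are at most
[u n + G n + e n] ([window_descent_inside]).

The hypothesis on the values of [f] gives [kappa * |u n| `^ q <= G n] with
[q = 2 / mu] as soon as [|u n|] is small. Once [u] is small it therefore stays
small, because at any fixed positive level the decrease beats the vanishing
noise; as 0 is the lower limit of [u], [u] tends to 0 ([cvg_of_descent]).

For the rate, compare with [psi n = gam n `^ (- p)], where [p = mu * m] and
[m = min (r, 1 / (2 - mu))], with [1 / 0 = +oo]. From [m <= r] one gets
[p * q = 2 * m <= 2 * r]: where [|u|] is a large multiple of [psi], the decrease
dominates the noise. From [p * (q - 1) = m * (2 - mu) <= 1] one gets that the
recursion [u' = - kappa * u `^ q] decays at least as fast as [psi], up to a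
constant factor in case of equality. Thus [u] cannot stay above [K * psi], and
cannot be below [- K * psi] either, since it would then never come back to 0
([rate_bigO]). With vanishing noise and [r < 1 / (2 - mu)] both comparisons are
won with any positive [K] ([rate_littleo]).

A window inequality converts the bound on [u] into one on [G], that is, on the
squared gradient. The gradient tends to 0, so that [fhat] is a critical value
and [|u n|] bounds the distance to the critical values; the distance to the
critical points is bounded by a power [nu] of the gradient. *)

Set Implicit Arguments.
Unset Strict Implicit.
Unset Printing Implicit Defensive.

Import Order.TTheory GRing.Theory Num.Theory.
Import numFieldNormedType.Exports.

Local Open Scope classical_set_scope.
Local Open Scope ring_scope.

(** * The Euclidean norm *)

Section euclidean.
Context (R : realType) (d : nat).
Implicit Types x y z v : 'rV[R]_d.

Definition dot x y : R := \sum_(i < d) x ord0 i * y ord0 i.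

Lemma dotC x y : dot x y = dot y x.
Proof. by apply: eq_bigr => i _; rewrite mulrC. Qed.

Lemma dotDr x y z : dot x (y + z) = dot x y + dot x z.
Proof. by rewrite -big_split; apply: eq_bigr => i _; rewrite mxE mulrDr. Qed.

Lemma dotZr a x y : dot x (a *: y) = a * dot x y.
Proof. by rewrite /dot big_distrr; apply: eq_bigr => i _; rewrite mxE mulrCA. Qed.

Lemma dotNr x y : dot x (- y) = - dot x y.
Proof. by rewrite -scaleN1r dotZr mulN1r. Qed.

Lemma dotBl x y z : dot (x - y) z = dot x z - dot y z.
Proof. by rewrite dotC dotDr dotNr !(dotC z). Qed.

Lemma dotDl x y z : dot (x + y) z = dot x z + dot y z.
Proof. by rewrite dotC dotDr !(dotC z). Qed.

Lemma dotxx_ge0 x : 0 <= dot x x.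
Proof. by apply: sumr_ge0 => i _; rewrite -expr2 sqr_ge0. Qed.

Lemma enorm_ge0 x : 0 <= enorm x.
Proof. exact: sqrtr_ge0. Qed.

Lemma enorm_sqr x : enorm x ^+ 2 = dot x x.
Proof.
rewrite /enorm sqr_sqrtr; first by apply: eq_bigr => i _; rewrite expr2.
by apply: sumr_ge0 => i _; rewrite sqr_ge0.
Qed.

Lemma coord_le_enorm x i : `|x ord0 i| <= enorm x.
Proof.
rewrite -(@ler_pXn2r _ 2) ?nnegrE ?normr_ge0 ?enorm_ge0//.
rewrite enorm_sqr /dot (bigD1 i)//= real_normK ?num_real// -expr2 lerDl.
by apply: sumr_ge0 => j _; rewrite -expr2 sqr_ge0.
Qed.

Lemma enorm_eq0 x : enorm x = 0 -> x = 0.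
Proof.
move=> x0; apply/rowP => i; rewrite mxE; apply/eqP.
by rewrite -normr_le0 -x0 coord_le_enorm.
Qed.

Lemma cauchy_schwarz x y : dot x y <= enorm x * enorm y.
Proof.
set a := enorm x; set b := enorm y.
have a0 : 0 <= a := enorm_ge0 x.
have b0 : 0 <= b := enorm_ge0 y.
have [ab0|abn0] := eqVneq (a * b) 0.
  move/eqP: (ab0); rewrite mulf_eq0 ab0 => /orP[]/eqP/enorm_eq0 ->.
    by rewrite /dot big1// => i _; rewrite mxE mul0r.
  by rewrite /dot big1// => i _; rewrite mxE mulr0.
have ab_gt0 : 0 < a * b by rewrite lt_def abn0 mulr_ge0.
have := dotxx_ge0 (b *: x - a *: y).
rewrite dotBl !dotDr !dotNr !dotZr !(dotC (_ *: _)) !dotZr -!enorm_sqr.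
rewrite -/a -/b (dotC y x) => H.
rewrite -(ler_pM2l ab_gt0); nra.
Qed.

Lemma enormD x y : enorm (x + y) <= enorm x + enorm y.
Proof.
rewrite -(@ler_pXn2r _ 2) ?nnegrE ?addr_ge0 ?enorm_ge0//.
rewrite enorm_sqr dotDl !dotDr (dotC y x) -!enorm_sqr.
have := cauchy_schwarz x y; nra.
Qed.

Lemma enormZ a x : enorm (a *: x) = `|a| * enorm x.
Proof.
rewrite /enorm -sqrtr_sqr -sqrtrM ?sqr_ge0//; congr Num.sqrt.
by rewrite big_distrr; apply: eq_bigr => i _; rewrite mxE exprMn.
Qed.

Lemma enormN x : enorm (- x) = enorm x.
Proof. by rewrite -scaleN1r enormZ normrN1 mul1r. Qed.

Lemma enormB x y : enorm (x - y) = enorm (y - x).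
Proof. by rewrite -enormN opprB. Qed.

Lemma enorm0 : enorm (0 : 'rV[R]_d) = 0.
Proof. by rewrite -(scale0r 0) enormZ normr0 mul0r. Qed.

Lemma enorm_le_sub x y : enorm x <= enorm y + enorm (x - y).
Proof. by rewrite -{1}(subrK y x) addrC enormD. Qed.

Lemma enorm_sum (I : Type) (s : seq I) (P : pred I) (F : I -> 'rV[R]_d) :
  enorm (\sum_(i <- s | P i) F i) <= \sum_(i <- s | P i) enorm (F i).
Proof.
elim/big_rec2 : _ => [|i y x _ xy]; first by rewrite enorm0.
by apply: le_trans (enormD _ _) _; rewrite lerD2l.
Qed.

(** The topology of row vectors comes from the sup norm; the two-sided comparison
that follows makes it available for the Euclidean norm. *)
Lemma norm_le_enorm x : `|x| <= enorm x.
Proof.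
have -> : `|x| = mx_norm x by [].
rewrite mx_normrE; apply: bigmax_le => [|[i j] _/=].
  exact: enorm_ge0.
by rewrite ord1 coord_le_enorm.
Qed.

Lemma enorm_le_norm x : enorm x <= d%:R * `|x|.
Proof.
rewrite [in enorm _](row_sum_delta x).
apply: le_trans (enorm_sum _ _ _) _.
have -> : d%:R * `|x| = \sum_(i < d) `|x| by rewrite sumr_const card_ord mulr_natl.
apply: ler_sum => i _; rewrite enormZ.
have -> : enorm (delta_mx ord0 i : 'rV[R]_d) = 1.
  rewrite /enorm (bigD1 i)//= !mxE !eqxx expr1n big1 ?addr0 ?sqrtr1//.
  by move=> j ji; rewrite !mxE (negbTE ji) andbF expr0n.
have -> : `|x| = mx_norm x by [].
rewrite mulr1 mx_normrE.
exact: (le_bigmax _ (fun ij : 'I_1 * 'I_d => `|x ij.1 ij.2|) (ord0, i)).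
Qed.

Lemma near_enorm_lt z (e : R) : 0 < e -> \forall y \near z, enorm (y - z) < e.
Proof.
move=> e0; have d0 : 0 < e / d.+1%:R by rewrite divr_gt0.
apply: filterS (nbhsx_ballx z _ d0) => y; rewrite -ball_normE /= distrC => yz.
apply: le_lt_trans (enorm_le_norm _) _.
rewrite ltr_pdivlMr// in yz; apply: le_lt_trans yz.
by rewrite mulrC ler_wpM2l// ler_nat leqnSn.
Qed.

Lemma closed_enorm_ball (z : 'rV[R]_d) b : closed [set y | enorm (z - y) <= b].
Proof.
have c : continuous (fun y => enorm (z - y)).
  move=> x; apply/(@cvgrPdist_lt _ R _ _ (nbhs_filter x)) => e e0.
  apply: filterS (near_enorm_lt x e0) => y /= xy; apply: le_lt_trans xy.
  have zyx : z - y = (z - x) + (x - y) by rewrite subrKA.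
  have zxy : z - x = (z - y) + (y - x) by rewrite subrKA.
  have := enormD (z - x) (x - y); have := enormD (z - y) (y - x).
  rewrite -zyx -zxy (enormB x y) ler_norml => ? ?; apply/andP; split; lra.
exact: (closed_comp (D := [set r : R | r <= b]) (fun y _ => c y) (@closed_le _ b)).
Qed.

Lemma enorm_bounded_set (A : set 'rV[R]_d) b :
  (forall y, A y -> enorm y <= b) -> bounded_set A.
Proof.
move=> Ab; exists b; split; first exact: num_real.
move=> M bM y Ay; apply: le_trans (norm_le_enorm _) _.
by apply: le_trans (Ab _ Ay) (ltW bM).
Qed.

Lemma compact_enorm_ball b : compact [set y : 'rV[R]_d | enorm y <= b].
Proof.
apply: bounded_closed_compact; first exact: (@enorm_bounded_set _ b).
rewrite (_ : [set _ | _] = [set y | enorm (0 - y) <= b]).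
  exact: closed_enorm_ball.
by apply/seteqP; split => y/=; rewrite sub0r enormN.
Qed.

End euclidean.

(** * Gradients with locally Lipschitz dependence *)

Section gradient.
Context (R : realType) (d : nat).
Implicit Types x y z v : 'rV[R]_d.

Lemma derive_dot_grad (f : 'rV[R]_d -> R) x v :
  differentiable f x -> 'D_v f x = dot (grad f x) v.
Proof.
move=> fx; rewrite deriveE// {1}(row_sum_delta v) linear_sum; apply: eq_bigr => i _.
by rewrite linearZ/= mxE -deriveE// mulrC.
Qed.

Lemma is_derive_along_line (f : 'rV[R]_d -> R) x v (s : R) :
  (forall y, differentiable f y) ->
  is_derive s 1 (fun t : R => f (x + t *: v)) (dot (grad f (x + s *: v)) v).
Proof.
move=> fd.
have E : (fun h : R => h^-1 *: (((fun t : R => f (x + t *: v)) \o shift s) (h *: (1 : R))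
                   - f (x + s *: v))) =
         (fun h : R => h^-1 *: ((f \o shift (x + s *: v)) (h *: v) - f (x + s *: v))).
  apply/funext => h /=; congr (_ *: (f _ - _)).
  by rewrite [h *: 1]mulr1 scalerDl addrCA addrC -addrA.
apply: DeriveDef.
  rewrite /derivable E; exact: (@diff_derivable _ _ _ f (x + s *: v) v (fd _)).
by rewrite -derive_dot_grad// /derive E.
Qed.

(** The quadratic upper bound holds on every Euclidean ball because a ball is
convex: the whole segment from [x] to [y] stays where the gradient is
Lipschitz, and the mean value theorem applies along it. *)
Lemma lipschitz_grad_upper_bound (f : 'rV[R]_d -> R) (b L : R) x y :
  (forall z, differentiable f z) -> 0 <= L ->
  (forall p q, enorm p <= b -> enorm q <= b ->
     enorm (grad f p - grad f q) <= L * enorm (p - q)) ->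
  enorm x <= b -> enorm y <= b ->
  f y - f x <= dot (grad f x) (y - x) + L * enorm (y - x) ^+ 2.
Proof.
move=> fd L0 lip xb yb; set v := y - x.
pose phi (t : R) := f (x + t *: v).
have dphi (t : R) : is_derive t (1 : R) phi (dot (grad f (x + t *: v)) v).
  exact: is_derive_along_line.
have [|c] := @MVT_segment _ phi (fun t => dot (grad f (x + t *: v)) v) 0 1 ler01.
  by apply: derivable_within_continuous => t _; case: (dphi t).
rewrite in_itv/= => /andP[c0 c1].
rewrite subr0 mulr1 /phi scale1r scale0r addr0 [x + v]addrC subrK => ->.
rewrite -lerBlDl -dotBl.
have cb : enorm (x + c *: v) <= b.
  have -> : x + c *: v = (1 - c) *: x + c *: y.
    by rewrite scalerBr scalerBl scale1r addrA addrAC.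
  apply: le_trans (enormD _ _) _; rewrite !enormZ !ger0_norm// ?subr_ge0//.
  have := ler_wpM2l c0 yb; have := @ler_wpM2l _ (1 - c) _ _ _ xb.
  rewrite subr_ge0 => /(_ c1); lra.
apply: le_trans (cauchy_schwarz _ _) _.
rewrite expr2 mulrA ler_wpM2r ?enorm_ge0//.
apply: le_trans (lip _ _ cb xb) _.
rewrite addrAC subrr add0r enormZ ger0_norm// ler_wpM2l//.
by rewrite ler_piMl ?enorm_ge0.
Qed.

(** Off the diagonal of [K * K] the quotient of increments is locally bounded
because the map is continuous and the denominator does not vanish; on the
diagonal it is bounded by hypothesis. Compactness of [K * K] makes the bound
uniform. *)
Lemma locally_lipschitz_compact (g : 'rV[R]_d -> 'rV[R]_d) (K : set 'rV[R]_d) :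
  locally_lipschitz g -> compact K ->
  exists2 L, 1 <= L & forall y z, K y -> K z -> enorm (g y - g z) <= L * enorm (y - z).
Proof.
move=> gl cK.
have := (@compact_near_coveringP _ (K `*` K)).1 (compact_setX cK cK).
move=> /(_ R +oo (fun L p => enorm (g p.1 - g p.2) <= L * enorm (p.1 - p.2)) _).
case.
- move=> [y z] [/= Ky Kz].
  have [yz|yz] := eqVneq y z.
    have [U Uy [L UL]] := gl y.
    exists (U `*` U, [set M | L <= M]).
      split=> /=; last by apply: nbhs_pinfty_ge; exact: num_real.
      by exists (U, U) => //=; split => //=; rewrite -yz.
    move=> [[p q] M] [[/= Up Uq] LM] /=.
    by apply: le_trans (UL _ _ Up Uq) _; rewrite ler_wpM2r ?enorm_ge0.
  have [U Uy [L UL]] := gl y; have [V Vz [L' VL']] := gl z.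
  have yz0 : 0 < enorm (y - z).
    rewrite lt_def enorm_ge0 andbT; apply: contra_neq yz => /enorm_eq0 yz.
    by apply/eqP; rewrite -subr_eq0 yz.
  have e0 : 0 < enorm (y - z) / 4 by rewrite divr_gt0.
  have Uy' := nbhs_singleton Uy; have Vz' := nbhs_singleton Vz.
  set e := enorm (y - z) / 4 in e0.
  (* Within distance [e] of [y] and [z], the increment of [g] is at most [B] and
     the distance of the two points at least [2 * e]. *)
  pose B := (Num.max L 0) * e + enorm (g y - g z) + (Num.max L' 0) * e.
  exists ((U `&` [set p | enorm (p - y) < e]) `*` (V `&` [set p | enorm (p - z) < e]),
          [set M | B / (2 * e) <= M]).
    split=> /=; last by apply: nbhs_pinfty_ge; exact: num_real.
    exists (U `&` [set p | enorm (p - y) < e], V `&` [set p | enorm (p - z) < e]) => //=.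
    by split; apply: filterI => //; exact: near_enorm_lt.
  move=> [[p q] M] [[/= [Up py] [Vq qz]] BM].
  have e1 := UL _ _ Up Uy'; have e2 := VL' _ _ Vz' Vq.
  have max_bound (a t : R) : 0 <= t -> t <= e -> a * t <= Num.max a 0 * e.
    move=> t0 te; apply: (@le_trans _ _ (Num.max a 0 * t)).
      by rewrite ler_wpM2r// le_max lexx.
    by rewrite ler_wpM2l// le_max lexx orbT.
  have {}e1 : enorm (g p - g y) <= Num.max L 0 * e.
    by apply: le_trans e1 _; apply: max_bound; [exact: enorm_ge0|exact: ltW].
  have {}e2 : enorm (g z - g q) <= Num.max L' 0 * e.
    apply: le_trans e2 _; rewrite (enormB z q).
    by apply: max_bound; [exact: enorm_ge0|exact: ltW].
  have gpq : enorm (g p - g q) <= B.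
    have -> : g p - g q = (g p - g y) + ((g y - g z) + (g z - g q)).
      by rewrite subrKA subrKA.
    apply: le_trans (enormD _ _) _; rewrite /B -[leRHS]addrA lerD//.
    by apply: le_trans (enormD _ _) _; rewrite lerD2l.
  have pq : 2 * e <= enorm (p - q).
    have : enorm (y - z) <= enorm (y - p) + (enorm (p - q) + enorm (q - z)).
      rewrite -(subrKA p y (- z)) -(subrKA q p (- z)).
      apply: le_trans (enormD _ _) _; rewrite lerD2l; exact: enormD.
    rewrite (enormB y p) (_ : enorm (y - z) = 4 * e); last by rewrite /e; field.
    lra.
  have B0 : 0 <= B by apply: le_trans gpq; exact: enorm_ge0.
  apply: le_trans gpq _; rewrite -[leLHS](@divfK _ (2 * e)) ?gt_eqF ?mulr_gt0//.
  apply: ler_pM => //; first by rewrite divr_ge0// mulr_ge0// ltW.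
  by rewrite mulr_ge0// ltW.
move=> M0 [M0r HM]; exists (Num.max 1 (M0 + 1)); first by rewrite le_max lexx.
move=> y z Ky Kz.
have M1 : M0 < Num.max 1 (M0 + 1) by rewrite lt_max ltrDl ltr01 orbT.
exact: (HM _ M1 (y, z)).
Qed.

End gradient.

(** * Step sizes, windows and accumulated noise *)

Section steps.
Context (R : realType) (alpha : nat -> R).
Hypothesis alpha_gt0 : forall n, 0 < alpha n.
Hypothesis alpha_cvg0 : alpha n @[n --> \oo] --> 0.
Hypothesis alpha_sum : (\sum_(0 <= n <oo) (alpha n)%:E)%E = +oo%E.

Lemma gamS n : gam alpha n.+1 = gam alpha n + alpha n.
Proof. by rewrite /gam big_nat_recr. Qed.

Lemma gam_le m n : (m <= n)%N -> gam alpha m <= gam alpha n.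
Proof.
elim: n => [|n IH]; first by rewrite leqn0 => /eqP ->.
rewrite leq_eqVlt => /orP[/eqP -> //|]; rewrite ltnS => /IH mn.
by rewrite gamS ler_wpDr// ltW.
Qed.

Lemma gam_lt_inv m n : gam alpha m < gam alpha n -> (m < n)%N.
Proof. by move=> mn; rewrite ltnNge; apply/negP => /gam_le; rewrite leNgt mn. Qed.

Lemma gam_ge_near A : \forall n \near \oo, A <= gam alpha n.
Proof.
have [[m Am]|/forallNP noA] := pselect (exists m, A <= gam alpha m).
  by near=> n; apply: le_trans Am (gam_le _); near: n; exact: nbhs_infty_ge.
suff : (\sum_(0 <= n <oo) (alpha n)%:E <= A%:E)%E by rewrite alpha_sum.
apply: lime_le; first by apply: is_cvg_nneseries => n _ _; rewrite lee_fin ltW.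
near=> n; rewrite sumEFin lee_fin ltW// ltNge; exact/negP/noA.
Unshelve. all: by end_near. Qed.

Lemma aidxP t n : 0 < t ->
  let K := aidx alpha n t in
  [/\ (n <= K)%N, gam alpha K - gam alpha n <= t &
     forall j, (n <= j)%N -> gam alpha j - gam alpha n <= t -> (j <= K)%N].
Proof.
move=> t0 K.
have [N _ HN] := gam_ge_near (gam alpha n + t + 1).
pose B k := (n <= k)%N && (gam alpha k - gam alpha n <= t).
have exB : exists k, B k by exists n; rewrite /B leqnn subrr ltW.
have Bub k : B k -> (k <= N)%N.
  move=> /andP[_ kt]; rewrite leqNgt; apply/negP => /ltnW Nk.
  have := HN k Nk; rewrite /=; lra.
have [m /andP[nm mt] mmax] := ex_maxnP exB Bub.
have : K \in [set k | ([set k | (n <= k)%N /\ gam alpha k - gam alpha n <= t] k) /\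
     forall j, [set k | (n <= k)%N /\ gam alpha k - gam alpha n <= t] j -> (j <= k)%N].
  rewrite inE; apply: xgetPex; exists m; split => // j [nj jt].
  by apply: mmax; rewrite /B nj.
rewrite inE => -[[nK Kt] Kmax]; split => // j nj jt; exact: Kmax.
Qed.

Lemma aidx_le t t' n : 0 < t -> t <= t' -> (aidx alpha n t <= aidx alpha n t')%N.
Proof.
move=> t0 tt'.
have [nK Kt _] := aidxP n t0; have [_ _ ] := aidxP n (lt_le_trans t0 tt').
by apply => //; exact: le_trans tt'.
Qed.

(** A window of length [t] falls short of [t] by less than one step. *)
Lemma aidx_progress t : 0 < t ->
  \forall n \near \oo, gam alpha n + t / 2 <= gam alpha (aidx alpha n t).
Proof.
move=> t0; have t20 : 0 < t / 2 by rewrite divr_gt0.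
have /cvgrPdist_lt/(_ _ t20)[N _ HN] := alpha_cvg0.
exists N => // n /= Nn; have [nK Kt Kmax] := aidxP n t0.
set K := aidx _ _ _ in nK Kt Kmax *.
have := HN K (leq_trans Nn nK); rewrite /= sub0r normrN gtr0_norm// => aK.
rewrite leNgt; apply/negP => lt_half.
have : (K.+1 <= K)%N by apply: Kmax; [exact: leqW|rewrite gamS; lra].
by rewrite ltnn.
Qed.

End steps.

(** Summation by parts: nonincreasing weights keep a bound on partial sums. *)
Lemma abel_enorm_bound (R : realType) (d : nat) (h : nat -> R)
    (y : nat -> 'rV[R]_d) (n k : nat) (W : R) :
  (n <= k)%N -> 0 <= W -> (forall i, (n <= i)%N -> 0 <= h i.+1 <= h i) -> 0 <= h n ->
  (forall j, (n <= j < k)%N -> enorm (\sum_(n <= i < j.+1) y i) <= W) ->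
  enorm (\sum_(n <= i < k) h i *: y i) <= h n * W.
Proof.
move=> nk W0 hdec hn0; move: nk; rewrite leq_eqVlt => /orP[/eqP <- _|].
  by rewrite big_geq// enorm0 mulr_ge0.
case: k => // k; rewrite ltnS => nk yW.
have H j : (n <= j <= k)%N -> enorm (\sum_(n <= i < j.+1) h i *: y i
    - h j *: \sum_(n <= i < j.+1) y i) <= (h n - h j) * W /\ 0 <= h j.
  elim: j => [|j IH].
    rewrite leqn0 => /andP[/eqP n0 _]; move: hn0; rewrite n0 !big_nat1 !subrr enorm0 mul0r.
    by split.
  move=> /andP[]; rewrite leq_eqVlt => /orP[/eqP nj _|].
    by move: hn0; rewrite nj !big_nat1 !subrr enorm0 mul0r; split.
  rewrite ltnS => nj jk; have [] := IH; first by rewrite nj ltnW.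
  move=> IHj hj0; have /andP[hj1 hjj] := hdec _ nj; split => //.
  rewrite big_nat_recr/=; last exact: leqW.
  rewrite [X in _ - _ *: X]big_nat_recr/=; last exact: leqW.
  set A := \sum_(_ <= _ < _) _; set Y := \sum_(_ <= _ < _) _.
  have -> : A + h j.+1 *: y j.+1 - h j.+1 *: (Y + y j.+1)
      = (A - h j *: Y) + (h j - h j.+1) *: Y.
    rewrite scalerDr scalerBl opprD addrACA subrr addr0.
    by rewrite addrA subrK.
  apply: le_trans (enormD _ _) _; rewrite enormZ ger0_norm ?subr_ge0//.
  have := yW j; rewrite nj ltnS (ltnW jk) => /(_ isT) => YW.
  have : (h j - h j.+1) * enorm Y <= (h j - h j.+1) * W.
    by rewrite ler_wpM2l// subr_ge0.
  by move: IHj; rewrite -/A -/Y; lra.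
have [] := H k; first by rewrite nk leqnn.
move=> Hk hk0; have := yW k; rewrite nk ltnSn => /(_ isT) => YW.
apply: le_trans (enorm_le_sub _ (h k *: \sum_(n <= i < k.+1) y i)) _.
rewrite enormZ ger0_norm//.
have := ler_wpM2l hk0 YW; lra.
Qed.

(** One sequence that dominates the noise on every window of length at most 1:
it is fixed before any bound on the limsup is chosen, so that when the limsup
vanishes it is eventually below each multiple of [gam n `^ (- r)]. The sum stops
before [k], whence the upper limit [(aidx alpha n 1).+1] for [k]. *)
Definition window_noise (R : realType) (d : nat) (alpha : nat -> R)
    (v : nat -> 'rV[R]_d) (n : nat) : R :=
  \big[Num.max/0]_(n <= k < (aidx alpha n 1).+1)
    enorm (\sum_(n <= i < k) alpha i *: v i).

Lemma window_noise_ge (R : realType) (d : nat) (alpha : nat -> R)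
    (v : nat -> 'rV[R]_d) (n k : nat) : (n <= k <= aidx alpha n 1)%N ->
  enorm (\sum_(n <= i < k) alpha i *: v i) <= window_noise alpha v n.
Proof.
move=> nk; apply: (le_bigmax_seq 0 k xpredT
  (fun k => enorm (\sum_(n <= i < k) alpha i *: v i))) => //.
by rewrite mem_index_iota ltnS.
Qed.

(** The weights [gam i `^ (- r)] that undo those of the noise are
nonincreasing, so summation by parts applies and the first one comes out. *)
Lemma noise_window_bound (R : realType) (d : nat) (alpha : nat -> R) (r b : R)
    (v : nat -> 'rV[R]_d) :
  (forall n, 0 < alpha n) -> 0 <= r ->
  (noise_limsup alpha r v < b%:E)%E ->
  \forall n \near \oo, window_noise alpha v n <= b * gam alpha n `^ (- r).
Proof.
move=> a0 r0 /ereal_inf_lt[_ [V Vn <-]] supV.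
near=> n.
have n0 : (0 < n)%N by near: n; exact: nbhs_infty_gt.
have gpos i : (n <= i)%N -> 0 < gam alpha i.
  move=> ni; apply: (lt_le_trans (a0 0%N)).
  have -> : alpha 0%N = gam alpha 1 by rewrite /gam big_nat1.
  by rewrite gam_le// (leq_trans n0).
have maxb : \big[Num.max/0]_(n <= k < aidx alpha n 1)
       enorm (\sum_(n <= i < k.+1) (alpha i * gam alpha i `^ r) *: v i) <= b.
  rewrite -lee_fin; apply: le_trans (ltW supV); apply: ereal_sup_ubound.
  exists n => //; near: n; exact: Vn.
have b0 : 0 <= b by apply: le_trans maxb; exact: bigmax_ge_id.
rewrite /window_noise big_nat; apply: bigmax_le => [|k].
  by rewrite mulr_ge0// powR_ge0.
rewrite ltnS => /andP[nk ka].
have -> : \sum_(n <= i < k) alpha i *: v i =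
    \sum_(n <= i < k) gam alpha i `^ (- r) *: ((alpha i * gam alpha i `^ r) *: v i).
  apply: eq_big_nat => i /andP[ni _]; rewrite scalerA mulrCA -powRD.
    by rewrite addNr powRr0 mulr1.
  by rewrite (gt_eqF (gpos _ ni)) implybT.
rewrite mulrC; apply: abel_enorm_bound => //; last 2 first.
- exact: powR_ge0.
- move=> j /andP[nj jk]; apply: le_trans maxb.
  apply: (le_bigmax_seq 0 j xpredT (fun k => enorm (\sum_(n <= i < k.+1) _))) => //.
  by rewrite mem_index_iota nj (leq_trans jk).
move=> i ni; rewrite powR_ge0 !powRN lef_pV2 ?posrE ?powR_gt0 ?gpos ?leqW//=.
by rewrite ge0_ler_powR// ?nnegrE ?ltW ?gpos ?leqW// gamS ltrDl.
Unshelve. all: by end_near. Qed.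

(** * Descent over one window *)

Section window.
Context (R : realType) (d : nat) (f : 'rV[R]_d -> R) (alpha : nat -> R)
  (x v : nat -> 'rV[R]_d) (b L : R).
Hypothesis f_diff : forall z, differentiable f z.
Hypothesis alpha_gt0 : forall n, 0 < alpha n.
Hypothesis recursion : forall n, x n.+1 = x n - alpha n *: (grad f (x n) + v n).
Hypothesis x_ball : forall n, enorm (x n) <= b.
Hypothesis L_ge1 : 1 <= L.
Hypothesis grad_lip : forall y z, enorm y <= b -> enorm z <= b ->
  enorm (grad f y - grad f z) <= L * enorm (y - z).

Let s n k := gam alpha k - gam alpha n.

(** The drift is split into its value at the start of the window and its
variation, which the Lipschitz bound controls. *)
Lemma increment_decomposition n k : (n <= k)%N ->
  x k - x n = - (s n k *: grad f (x n))
    - \sum_(n <= i < k) alpha i *: (grad f (x i) - grad f (x n))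
    - \sum_(n <= i < k) alpha i *: v i.
Proof.
elim: k => [|k IH].
  by rewrite leqn0 => /eqP ->; rewrite !big_geq// /s !subrr scale0r !oppr0 !addr0.
rewrite leq_eqVlt => /orP[/eqP <-|].
  by rewrite !big_geq// /s !subrr scale0r !oppr0 !addr0.
rewrite ltnS => nk; rewrite !big_nat_recr//= recursion addrAC (IH nk).
rewrite /s gamS [gam alpha k + _ - _]addrAC scalerDl scalerDr scalerBr.
set A := _ *: _; set B := \sum_(_ <= _ < _) _; set C := \sum_(_ <= _ < _) _.
apply/rowP => i; rewrite !mxE; ring.
Qed.

(** Over a window of length at most [t] with [40 * L * t <= 1] the iterates
behave as one gradient step of length [s n k], up to the accumulated noise
[eps] and to a change of the gradient that the Lipschitz bound makes a small
multiple of the displacement itself. *)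
Section one_window.
Context (n K : nat) (t eps : R).
Hypothesis Lt : 40 * L * t <= 1.
Hypothesis Kt : s n K <= t.
Hypothesis noise : forall k, (n <= k <= K)%N ->
  enorm (\sum_(n <= i < k) alpha i *: v i) <= eps.
Hypothesis nK : (n <= K)%N.

Let g := enorm (grad f (x n)).

Let s_ge0 k : (n <= k)%N -> 0 <= s n k.
Proof. by move=> nk; rewrite subr_ge0 gam_le. Qed.

Let s_le_t k : (k <= K)%N -> s n k <= t.
Proof. by move=> kK; apply: le_trans Kt; rewrite lerB// gam_le. Qed.

Let eps_ge0 : 0 <= eps.
Proof. by apply: le_trans (noise (k := n) _); [exact: enorm_ge0|rewrite leqnn]. Qed.

Lemma gradient_variation_bound k : (n <= k)%N ->
  (forall i, (n <= i < k)%N -> enorm (x i - x n) <= 2 * (s n i * g + eps)) ->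
  enorm (\sum_(n <= i < k) alpha i *: (grad f (x i) - grad f (x n)))
  <= 2 * L * s n k * (s n k * g + eps).
Proof.
move=> nk H; apply: le_trans (enorm_sum _ _ _) _.
apply: (@le_trans _ _ (\sum_(n <= i < k) alpha i * (2 * L * (s n k * g + eps)))).
  rewrite big_nat [leRHS]big_nat; apply: ler_sum => i /[dup] nik /andP[ni ik].
  rewrite enormZ gtr0_norm//; apply: ler_wpM2l; first exact: ltW.
  apply: le_trans (grad_lip (x_ball _) (x_ball _)) _.
  rewrite (mulrC 2) -mulrA ler_wpM2l ?(le_trans ler01)//.
  apply: le_trans (H _ nik) _; rewrite ler_wpM2l// lerD2r ler_wpM2r ?enorm_ge0//.
  by rewrite lerB// gam_le// ltnW.
rewrite -mulr_suml (_ : \sum_(n <= i < k) alpha i = s n k).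
  by rewrite le_eqVlt; apply/orP; left; apply/eqP; ring.
by rewrite /s /gam (big_cat_nat (n := n) _ (m := 0%N) (p := k))//= addrAC subrr add0r.
Qed.

(** A discrete Gronwall argument: the variation of the gradient over the window is
bounded by the earlier displacements, with a factor [2 * L * t <= 1]. *)
Lemma displacement_bound k : (n <= k <= K)%N ->
  enorm (x k - x n) <= 2 * (s n k * g + eps).
Proof.
elim/ltn_ind: k => k IH /andP[nk kK].
have V : enorm (\sum_(n <= i < k) alpha i *: (grad f (x i) - grad f (x n)))
    <= 2 * L * s n k * (s n k * g + eps).
  apply: gradient_variation_bound => // i /andP[ni ik].
  by apply: IH => //; rewrite ni (leq_trans (ltnW ik)).
rewrite increment_decomposition//.
apply: le_trans (enormD _ _) _; rewrite enormN.
apply: le_trans (lerD (enormD _ _) (noise _)) _; first by rewrite nk.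
rewrite !enormN enormZ ger0_norm ?s_ge0// -/g.
have s0 := s_ge0 nk; have st := s_le_t kK; have g0 : 0 <= g := enorm_ge0 _.
have L0 : 0 <= L by exact: le_trans ler01 L_ge1.
have Ls : 2 * L * s n k <= 1 by have := ler_wpM2l L0 st; have := Lt; lra.
have := ler_wpM2r (addr_ge0 (mulr_ge0 s0 g0) eps_ge0) Ls; lra.
Qed.

Lemma window_descent k : (n <= k <= K)%N ->
  f (x k) - f (x n) <= - (3 / 4) * s n k * g ^+ 2 + 2 * g * eps + 8 * L * eps ^+ 2.
Proof.
move=> /[dup] nkK /andP[nk kK].
have L0 : 0 <= L by exact: le_trans ler01 L_ge1.
have s0 := s_ge0 nk; have st := s_le_t kK; have g0 : 0 <= g := enorm_ge0 _.
have := lipschitz_grad_upper_bound f_diff L0 grad_lip (x_ball n) (x_ball k).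
move=> /le_trans; apply.
have D := displacement_bound nkK.
have D2 : L * enorm (x k - x n) ^+ 2 <= L * (8 * (s n k * g) ^+ 2 + 8 * eps ^+ 2).
  rewrite ler_wpM2l//; apply: (@le_trans _ _ ((2 * (s n k * g + eps)) ^+ 2)).
    rewrite ler_pXn2r ?nnegrE ?enorm_ge0//.
    by rewrite mulr_ge0// addr_ge0// mulr_ge0.
  have := sqr_ge0 (s n k * g - eps); lra.
have V : enorm (\sum_(n <= i < k) alpha i *: (grad f (x i) - grad f (x n)))
    <= 2 * L * s n k * (s n k * g + eps).
  apply: gradient_variation_bound => // i /andP[ni ik].
  by apply: displacement_bound; rewrite ni (leq_trans (ltnW ik)).
set S := \sum_(n <= i < k) alpha i *: (grad f (x i) - _) in V.
set N := \sum_(n <= i < k) alpha i *: v i.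
have Ndot : dot (grad f (x n)) (x k - x n)
    <= - s n k * g ^+ 2 + g * enorm S + g * eps.
  rewrite increment_decomposition// !dotDr !dotNr dotZr -enorm_sqr -/g mulNr.
  have := cauchy_schwarz (grad f (x n)) (- S); rewrite dotNr enormN -/g.
  have := cauchy_schwarz (grad f (x n)) (- N); rewrite dotNr enormN -/g.
  have := ler_wpM2l g0 (noise nkK); rewrite -/N -/S; lra.
have gV := ler_wpM2l g0 V.
have Ls : 40 * L * s n k <= 1 by have := ler_wpM2l L0 st; have := Lt; lra.
have A1 : 40 * L * s n k * (s n k * g ^+ 2) <= s n k * g ^+ 2.
  by apply: ler_piMl => //; rewrite mulr_ge0// sqr_ge0.
have A2 : 40 * L * s n k * (g * eps) <= g * eps.
  by apply: ler_piMl => //; rewrite mulr_ge0.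
have ge0 := mulr_ge0 g0 eps_ge0; lra.
Qed.

(** The two forms in which the window estimate is used: a full window gains a
multiple of the squared gradient, and inside the window [f] increases by at most
that same multiple, up to the noise. *)
Lemma window_descent_full : 0 < t -> t / 2 <= s n K ->
  f (x K) - f (x n) <= - (t / 4 * g ^+ 2) + (8 / t + 8 * L) * eps ^+ 2.
Proof.
move=> t0 sK; have := @window_descent K; rewrite nK leqnn => /(_ isT).
have := ler_wpM2r (sqr_ge0 g) sK.
(* Young's inequality for the cross term [2 * g * eps]. *)
have : 0 <= (t / 8) * (g - 8 / t * eps) ^+ 2 by rewrite mulr_ge0 ?sqr_ge0 ?divr_ge0 ?ltW.
rewrite (_ : t / 8 * _ ^+ 2 = t / 8 * g ^+ 2 - 2 * g * eps + 8 / t * eps ^+ 2); last first.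
  by field; rewrite gt_eqF.
lra.
Qed.

Lemma window_descent_inside k : 0 < t -> (n <= k <= K)%N ->
  f (x k) - f (x n) <= t / 4 * g ^+ 2 + (8 / t + 8 * L) * eps ^+ 2.
Proof.
move=> t0 nkK; have := window_descent nkK.
have /andP[nk _] := nkK.
have := mulr_ge0 (s_ge0 nk) (sqr_ge0 g).
have : 0 <= (t / 8) * (g - 8 / t * eps) ^+ 2 by rewrite mulr_ge0 ?sqr_ge0 ?divr_ge0 ?ltW.
rewrite (_ : t / 8 * _ ^+ 2 = t / 8 * g ^+ 2 - 2 * g * eps + 8 / t * eps ^+ 2); last first.
  by field; rewrite gt_eqF.
have := mulr_ge0 (ltW t0) (sqr_ge0 g).
lra.
Qed.

End one_window.
End window.

(** * Sequences that decrease from window to window *)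

(** Comparing powers of two times at distance at most [s]: the exponential form
turns a relative decrease by [p * s / a] into a power of the time. *)
Lemma powR_window (R : realType) (a c s p : R) :
  0 < a -> 0 <= p -> a <= c -> c <= a + s ->
  expR (- (p * s / a)) * a `^ (- p) <= c `^ (- p).
Proof.
move=> a0 p0 ac cas; have c0 := lt_le_trans a0 ac.
have c_exp : c <= a * expR (s / a).
  apply: le_trans cas _; have -> : a + s = a * (1 + s / a) by field; rewrite gt_eqF.
  by rewrite ler_pM2l// ?expR_ge1Dx.
rewrite !powRN expRN -invfM lef_pV2 ?posrE ?mulr_gt0 ?expR_gt0 ?powR_gt0//.
have -> : expR (p * s / a) * a `^ p = (a * expR (s / a)) `^ p.
  rewrite powRM ?expR_ge0 ?ltW// mulrC; congr (_ * _).
  by rewrite /powR gt_eqF ?expR_gt0// expRK mulrA.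
apply: ge0_ler_powR; rewrite ?nnegrE//; first exact: ltW.
by rewrite mulr_ge0 ?expR_ge0// ltW.
Qed.

Lemma powRN_le (R : realType) (a c p : R) :
  0 < a -> 0 <= p -> a <= c -> c `^ (- p) <= a `^ (- p).
Proof.
move=> a0 p0 ac; have c0 := lt_le_trans a0 ac.
rewrite !powRN lef_pV2 ?posrE ?powR_gt0//.
by apply: ge0_ler_powR; rewrite ?nnegrE// ltW.
Qed.

Section powers_of_time.
Context (R : realType) (gm : nat -> R).
Hypothesis gm_unbounded : forall A, \forall n \near \oo, A <= gm n.

Lemma powR_gm_unbounded (s c A : R) : 0 < s -> 0 < c -> 0 <= A ->
  \forall n \near \oo, A <= c * gm n `^ s.
Proof.
move=> s0 c0 A0; near=> n.
have gn : (A / c) `^ s^-1 <= gm n by near: n; exact: gm_unbounded.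
rewrite mulrC -ler_pdivrMr//.
have -> : A / c = ((A / c) `^ s^-1) `^ s.
  by rewrite -powRrM mulVf ?gt_eqF// powRr1// divr_ge0// ltW.
apply: ge0_ler_powR; rewrite ?nnegrE ?powR_ge0//; first exact: ltW.
by apply: le_trans gn; exact: powR_ge0.
Unshelve. all: by end_near. Qed.

Lemma powRN_gm_small (s K eta : R) : 0 < s -> 0 <= K -> 0 < eta ->
  \forall n \near \oo, K * gm n `^ (- s) <= eta.
Proof.
move=> s0 K0 eta0; near=> n.
have gn : 1 <= gm n by near: n; exact: gm_unbounded.
rewrite powRN ler_pdivrMr; last by rewrite powR_gt0// (lt_le_trans ltr01).
by near: n; exact: powR_gm_unbounded.
Unshelve. all: by end_near. Qed.

End powers_of_time.

(** Read [gm] as the time, [next n] as the end of the window that starts at [n],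
[u] as the difference between the objective and its limit, [G n] as the decrease
over a window and [e n] as the squared noise. *)
Section scalar.
Context (R : realType) (gm u G e : nat -> R) (next : nat -> nat) (n0 : nat).
Context (t delta kappa q : R).
Hypothesis t_gt0 : 0 < t.
Hypothesis gm_le : forall m n, (m <= n)%N -> gm m <= gm n.
Hypothesis gm_unbounded : forall A, \forall n \near \oo, A <= gm n.
Hypothesis next_gt : forall n, (n0 <= n)%N -> (n < next n)%N.
Hypothesis gm_next : forall n, (n0 <= n)%N -> gm (next n) <= gm n + t.
Hypothesis G_ge0 : forall n, 0 <= G n.
Hypothesis window_full : forall n, (n0 <= n)%N -> u (next n) <= u n - G n + e n.
Hypothesis window_inside : forall n k, (n0 <= n)%N -> (n <= k <= next n)%N ->
  u k <= u n + G n + e n.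
Hypothesis delta_gt0 : 0 < delta.
Hypothesis kappa_gt0 : 0 < kappa.
Hypothesis q_ge1 : 1 <= q.
Hypothesis lojasiewicz : forall n, (n0 <= n)%N -> `|u n| <= delta ->
  kappa * `|u n| `^ q <= G n.

Definition orbit n j := iter j next n.

Lemma orbit_ge n j : (n0 <= n)%N -> (n + j <= orbit n j)%N.
Proof.
move=> n0n; elim: j => [|j IH]; first by rewrite addn0.
rewrite addnS /=; apply: (leq_ltn_trans IH); apply: next_gt.
by apply: (leq_trans n0n); apply: leq_trans IH; exact: leq_addr.
Qed.

Lemma orbit_ge0 n j : (n0 <= n)%N -> (n <= orbit n j)%N.
Proof. by move=> /(orbit_ge j); apply: leq_trans; exact: leq_addr. Qed.

Lemma orbit_cover n k : (n0 <= n)%N -> (n <= k)%N ->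
  exists j, (orbit n j <= k <= orbit n j.+1)%N.
Proof.
move=> n0n nk.
have ex : exists j, (k < orbit n j)%N.
  by exists k.+1; apply: leq_trans (orbit_ge _ n0n); rewrite addnS ltnS leq_addl.
have [[|j] kj jmin] := ex_minnP ex; first by move: kj; rewrite ltnNge nk.
exists j; rewrite (ltnW kj) andbT leqNgt; apply/negP => /jmin.
by rewrite ltnn.
Qed.

(** A trajectory that is once below [eta] stays below [eta] at the later window
ends: between [eta / 2] and [eta] the decrease [G] beats the noise, and below
[eta / 2] the noise is too small to reach [eta]. *)
Lemma cvg_of_descent :
  (forall eta : R, 0 < eta -> \forall n \near \oo, e n <= eta) ->
  (forall eta : R, 0 < eta -> \forall n \near \oo, - eta <= u n) ->
  (forall eta : R, 0 < eta -> forall m, exists2 n, (m <= n)%N & u n <= eta) ->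
  forall eta : R, 0 < eta -> \forall n \near \oo, `|u n| <= eta.
Proof.
move=> e_small u_low u_rec.
(* It is enough to bound [u] from above, by levels where the lower bound on [G]
   is available. *)
suff H eta : 0 < eta -> eta <= delta -> \forall n \near \oo, u n <= 4 * eta.
  move=> eta eta0; set eta' := Num.min (eta / 4) delta.
  have eta'0 : 0 < eta' by rewrite lt_min delta_gt0 divr_gt0.
  have eta'd : eta' <= delta by rewrite ge_min lexx orbT.
  have eta'e : eta' <= eta / 4 by rewrite ge_min lexx.
  near=> n; rewrite ler_norml; apply/andP; split; first by near: n; exact: u_low.
  apply: (@le_trans _ _ (4 * eta')); first by near: n; exact: H.
  lra.
move=> eta0 etad; pose c := Num.min (eta / 2) (kappa * (eta / 2) `^ q).
have c0 : 0 < c by rewrite lt_min divr_gt0//= mulr_gt0// powR_gt0// divr_gt0.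
have [N1 _ HN1] := e_small _ c0; have [N2 _ HN2] := u_low _ eta0.
have [n mn un] := u_rec _ eta0 (maxn n0 (maxn N1 N2)).
have {mn} [n0n N1n N2n] : [/\ (n0 <= n)%N, (N1 <= n)%N & (N2 <= n)%N].
  by split; apply: leq_trans mn; rewrite !leq_max leqnn ?orbT.
have ec k : (n <= k)%N -> e k <= eta / 2 /\ e k <= kappa * (eta / 2) `^ q.
  move=> nk; have := HN1 k (leq_trans N1n nk); rewrite /= le_min => /andP[]//.
have orb j : u (orbit n j) <= eta.
  elim: j => [//|j IH]; have nj := orbit_ge0 j n0n.
  have := window_full (leq_trans n0n nj); have [e1 e2] := ec _ nj.
  have := G_ge0 (orbit n j); rewrite /orbit /= -/(orbit n j) => G0.
  have [uj|uj] := lerP (u (orbit n j)) (eta / 2); first by lra.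
  have u0 : 0 < u (orbit n j) by apply: lt_trans uj; rewrite divr_gt0.
  have := lojasiewicz (leq_trans n0n nj).
  rewrite gtr0_norm// => /(_ (le_trans IH etad)) Gj.
  have : kappa * (eta / 2) `^ q <= kappa * u (orbit n j) `^ q.
    rewrite ler_pM2l// ge0_ler_powR ?nnegrE ?ltW//; first exact: lt_le_trans q_ge1.
    by rewrite divr_gt0.
  lra.
exists n => // k /= nk.
have [j /andP[jk kj]] := orbit_cover n0n nk.
have nj := orbit_ge0 j n0n; have n0j := leq_trans n0n nj.
have := @window_inside _ k n0j; rewrite jk kj => /(_ isT).
have := window_full n0j; have := orb j; have [e1 _] := ec _ nj.
have := HN2 _ (leq_trans N2n (orbit_ge0 j.+1 n0n)).
rewrite /orbit /= -/(orbit n j); lra.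
Unshelve. all: by end_near. Qed.

(** The target rate [psi n] is [gm n `^ (- p)]. The hypotheses on [K] say that
above [K / 2 * psi] the decrease [G] dominates the noise and is strong enough
to follow [psi] from one window to the next; the bound on the exponent makes
that last requirement compatible with [gm] tending to infinity. *)
Section rate.
Context (p B K : R).
Hypothesis u_cvg0 : forall eta : R, 0 < eta -> \forall n \near \oo, `|u n| <= eta.
Hypothesis p_ge0 : 0 <= p.
Hypothesis B_ge0 : 0 <= B.
Hypothesis e_le : \forall n \near \oo, e n <= B * gm n `^ (- (p * q)).
Hypothesis K_gt0 : 0 < K.
Hypothesis K_gradient : 2 * B <= kappa * (K / 2) `^ q.
Hypothesis K_noise : B <= K / 4.
Hypothesis K_drift : \forall n \near \oo,
  (p + 1) * t <= kappa / 2 * (K / 2) `^ (q - 1) * gm n `^ (1 - p * (q - 1)).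

Let psi n := gm n `^ (- p).

Let psiq n : gm n `^ (- (p * q)) = psi n `^ q.
Proof. by rewrite /psi -powRrM mulNr. Qed.

Let q_ge0 : 0 <= q. Proof. exact: le_trans ler01 q_ge1. Qed.

Let K2_gt0 : 0 < K / 2. Proof. by rewrite divr_gt0. Qed.

Let gm_gt0_near : \forall n \near \oo, 0 < gm n.
Proof.
by have := gm_unbounded 1; apply: filterS => n; apply: lt_le_trans.
Qed.

(** Below [- K * psi] the trajectory could only go further down, which
contradicts the convergence to 0. *)
Lemma rate_lower : \forall n \near \oo, - K * psi n <= u n.
Proof.
have [N1 _ H1] := u_cvg0 delta_gt0; have [N2 _ H2] := e_le.
have [N3 _ H3] := gm_gt0_near.
pose N := maxn n0 (maxn N1 (maxn N2 N3)).
exists N => // n /= Nn; rewrite leNgt; apply/negP => un.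
have [n0n N1n N2n N3n] : [/\ (n0 <= n)%N, (N1 <= n)%N, (N2 <= n)%N & (N3 <= n)%N].
  by split; apply: leq_trans Nn; rewrite !leq_max leqnn ?orbT.
have psi_gt0 k : (n <= k)%N -> 0 < psi k.
  by move=> nk; apply: powR_gt0; apply: H3; exact: leq_trans nk.
have psi_le k : (n <= k)%N -> psi k <= psi n.
  by move=> nk; apply: powRN_le => //; [exact: H3|exact: gm_le].
have orb j : u (orbit n j) <= u n.
  elim: j => [//|j IH]; have nj := orbit_ge0 j n0n.
  rewrite /orbit /= -/(orbit n j); set m := orbit n j in nj IH *.
  apply: le_trans (window_full (leq_trans n0n nj)) _.
  suff : e m <= G m by lra.
  have um : K * psi m < - u m.
    have := ler_pM2l K_gt0 (psi m) (psi n); rewrite psi_le// => /esym K1.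
    by move: un; rewrite mulNr; lra.
  have psim0 := psi_gt0 _ nj.
  have um0 : u m < 0 by have := mulr_gt0 K_gt0 psim0; lra.
  apply: le_trans (lojasiewicz (leq_trans n0n nj) (H1 _ (leq_trans N1n nj))).
  apply: le_trans (H2 _ (leq_trans N2n nj)) _.
  rewrite psiq ltr0_norm//.
  apply: (@le_trans _ _ (kappa * (K / 2 * psi m) `^ q)).
    rewrite powRM ?(ltW K2_gt0) ?powR_ge0// mulrA ler_wpM2r ?powR_ge0//.
    by have := B_ge0; have := K_gradient; lra.
  rewrite ler_pM2l//; apply: ge0_ler_powR; rewrite ?nnegrE//.
  - by rewrite mulr_ge0 ?ltW.
  - by rewrite oppr_ge0 ltW.
  by have := mulr_gt0 K_gt0 psim0; lra.
have un0 : 0 < - u n / 2.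
  by have := mulr_gt0 K_gt0 (psi_gt0 _ (leqnn n)); move: un; rewrite mulNr; lra.
have [N4 _ H4] := u_cvg0 un0.
have := H4 (orbit n N4) (leq_trans (leq_addl _ _) (orbit_ge _ n0n)).
by rewrite /= ler_norml => /andP[+ _]; have := orb N4; lra.
Qed.

(** Half of [kappa * u `^ q] pays for the noise; in the other half [u] is factored
out, and [u >= K / 2 * psi] bounds the remaining factor [u `^ (q - 1)] below by a
multiple of [gm `^ (- p * (q - 1))], which [K_drift] compares with [1 / gm]. *)
Lemma rate_decay : \forall n \near \oo, K / 2 * psi n <= u n ->
  u (next n) <= u n * expR (- ((p + 1) * t / gm n)).
Proof.
near=> n => Ku.
have n0n : (n0 <= n)%N by near: n; exact: nbhs_infty_ge.
have gn : 0 < gm n by near: n; exact: gm_gt0_near.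
have un : `|u n| <= delta by near: n; exact: u_cvg0.
have en : e n <= B * gm n `^ (- (p * q)) by near: n; exact: e_le.
have psi0 : 0 < psi n by exact: powR_gt0.
have u0 : 0 < u n by apply: lt_le_trans Ku; rewrite mulr_gt0.
have := lojasiewicz n0n un; rewrite gtr0_norm// => Gn.
have noise : e n <= kappa / 2 * u n `^ q.
  apply: le_trans en _; rewrite psiq.
  apply: (@le_trans _ _ (kappa / 2 * (K / 2 * psi n) `^ q)).
    rewrite powRM ?(ltW K2_gt0) ?powR_ge0// mulrA ler_wpM2r ?powR_ge0//.
    by have := K_gradient; lra.
  rewrite ler_pM2l ?divr_gt0//; apply: ge0_ler_powR; rewrite ?nnegrE//; apply: ltW => //.
  by rewrite mulr_gt0.
have drift : (p + 1) * t / gm n <= kappa / 2 * u n `^ (q - 1).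
  apply: (@le_trans _ _ (kappa / 2 * (K / 2 * psi n) `^ (q - 1))); last first.
    rewrite ler_pM2l ?divr_gt0//.
    apply: ge0_ler_powR; rewrite ?nnegrE ?subr_ge0//; apply: ltW => //.
    by rewrite mulr_gt0.
  rewrite powRM ?(ltW K2_gt0) ?powR_ge0// mulrA ler_pdivrMr//.
  have -> : psi n `^ (q - 1) = gm n `^ (- p * (q - 1)) by rewrite /psi -powRrM.
  apply: (@le_trans _ _ (kappa / 2 * (K / 2) `^ (q - 1) * gm n `^ (1 - p * (q - 1)))).
    by near: n; exact: K_drift.
  rewrite [gm n `^ _]powRD; last by rewrite (gt_eqF gn) implybT.
  by rewrite (powRr1 (ltW gn)) mulNr -!mulrA (mulrC (gm n)).
have uq : u n `^ q = u n * u n `^ (q - 1).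
  by rewrite mulr_powRB1// ?ltW// (lt_le_trans ltr01).
apply: le_trans (window_full n0n) _.
apply: (@le_trans _ _ (u n * (1 + - ((p + 1) * t / gm n)))); last first.
  by rewrite ler_pM2l// expR_ge1Dx.
move: Gn noise; rewrite uq => Gn noise.
have := ler_wpM2l (ltW u0) drift; lra.
Unshelve. all: by end_near. Qed.

Let psi_window : \forall n \near \oo, forall k, (n <= k <= next n)%N ->
  3 / 4 * psi n <= psi k.
Proof.
near=> n => k /andP[nk kn].
have n0n : (n0 <= n)%N by near: n; exact: nbhs_infty_ge.
have gn : 0 < gm n by near: n; exact: gm_gt0_near.
have kt : gm k <= gm n + t by apply: le_trans (gm_next n0n); exact: gm_le.
apply: le_trans (powR_window gn p_ge0 (gm_le nk) kt).
rewrite ler_wpM2r ?powR_ge0//; apply: le_trans (expR_ge1Dx _).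
suff : p * t / gm n <= 1 / 4 by lra.
rewrite ler_pdivrMr// -ler_pdivrMl//.
by near: n; exact: gm_unbounded.
Unshelve. all: by end_near. Qed.

Let e_psi : \forall n \near \oo, e n <= K / 4 * psi n.
Proof.
near=> n; have g1 : 1 <= gm n by near: n; exact: gm_unbounded.
apply: (@le_trans _ _ (B * gm n `^ (- (p * q)))); first by near: n; exact: e_le.
apply: ler_pM => //; first exact: powR_ge0.
by apply: ler_powR => //; rewrite lerN2 ler_peMr.
Unshelve. all: by end_near. Qed.

(** In the upper half of the region the decay wins against that of [psi]; from the
lower half, the noise is too small to leave the region in one window. *)
Lemma rate_invariant : \forall n \near \oo, u n <= K * psi n ->
  u (next n) <= K * psi (next n).
Proof.
near=> n => un.
have n0n : (n0 <= n)%N by near: n; exact: nbhs_infty_ge.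
have gn : 0 < gm n by near: n; exact: gm_gt0_near.
have psi0 : 0 < psi n by exact: powR_gt0.
have nn := ltnW (next_gt n0n).
have [uK|Ku] := lerP (u n) (K / 2 * psi n).
  have en : e n <= K / 4 * psi n by near: n; exact: e_psi.
  have psin : 3 / 4 * psi n <= psi (next n).
    have Hw : forall k, (n <= k <= next n)%N -> 3 / 4 * psi n <= psi k.
      by near: n; exact: psi_window.
    by apply: Hw; rewrite nn leqnn.
  have := window_full n0n; have := G_ge0 n.
  by have := ler_wpM2l (ltW K_gt0) psin; lra.
apply: (@le_trans _ _ (u n * expR (- ((p + 1) * t / gm n)))).
  by move: (ltW Ku); near: n; exact: rate_decay.
apply: (@le_trans _ _ (K * psi n * expR (- ((p + 1) * t / gm n)))).
  by rewrite ler_wpM2r ?expR_ge0.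
rewrite -mulrA ler_pM2l// mulrC.
apply: le_trans (powR_window gn p_ge0 (gm_le nn) (gm_next n0n)).
rewrite ler_wpM2r ?powR_ge0// ler_expR lerN2 ler_pM2r ?invr_gt0// ler_pM2r//.
by rewrite lerDl.
Unshelve. all: by end_near. Qed.

(** Above [K * psi] the sequence decays at least like [gm `^ (- (p + 1))] along
window ends, so it must enter the region below [K * psi]. *)
Lemma rate_entry m : exists2 n, (m <= n)%N & u n <= K * psi n.
Proof.
have [N1 _ H1] := rate_decay; have [N2 _ H2] := gm_gt0_near.
pose n := maxn m (maxn n0 (maxn N1 N2)).
have [mn n0n N1n N2n] : [/\ (m <= n)%N, (n0 <= n)%N, (N1 <= n)%N & (N2 <= n)%N].
  by split; rewrite !leq_max leqnn ?orbT.
apply: contrapT => noentry.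
have above k : (n <= k)%N -> K * psi k < u k.
  move=> nk; rewrite ltNge; apply/negP => uk; apply: noentry; exists k => //.
  exact: leq_trans nk.
have gk k : (n <= k)%N -> 0 < gm k by move=> nk; apply: H2; exact: leq_trans nk.
have p1 : 0 <= p + 1 by rewrite addr_ge0.
pose A := u n * gm n `^ (p + 1).
have A0 : 0 < A.
  rewrite mulr_gt0 ?powR_gt0 ?gk//; apply: lt_trans (above n (leqnn n)).
  by rewrite mulr_gt0 ?powR_gt0 ?gk.
have orb j : u (orbit n j) <= A * gm (orbit n j) `^ (- (p + 1)).
  elim: j => [|j IH].
    by rewrite /A -mulrA powRN divff ?mulr1// gt_eqF ?powR_gt0 ?gk.
  have nj := orbit_ge0 j n0n; have n0j := leq_trans n0n nj.
  rewrite /orbit /= -/(orbit n j); set k := orbit n j in nj n0j IH *.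
  have Kk : K / 2 * psi k <= u k.
    have := above k nj; have : 0 < K * psi k by rewrite mulr_gt0 ?powR_gt0 ?gk.
    lra.
  apply: le_trans (H1 k (leq_trans N1n nj) Kk) _.
  apply: (@le_trans _ _ (A * gm k `^ (- (p + 1)) * expR (- ((p + 1) * t / gm k)))).
    by rewrite ler_wpM2r ?expR_ge0.
  rewrite -mulrA ler_pM2l// mulrC.
  apply: powR_window => //; [exact: gk|apply: gm_le|exact: gm_next].
  exact: ltnW (next_gt n0j).
have [N3 _ H3] := gm_unbounded (A / K).
have nj := orbit_ge0 N3 n0n; set k := orbit n N3 in nj.
have N3k : (N3 <= k)%N by apply: leq_trans (orbit_ge _ n0n); exact: leq_addl.
have := orb N3; rewrite leNgt => /negP; apply.
apply: le_lt_trans (above k nj); rewrite opprD powRD; last first.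
  by rewrite (gt_eqF (gk _ nj)) implybT.
rewrite (mulrC (_ `^ _)) mulrA ler_wpM2r ?powR_ge0// (powR_inv1 (ltW (gk _ nj))).
rewrite ler_pdivrMr ?gk// mulrC -ler_pdivrMr//.
exact: H3.
Qed.

(** At window ends the bound is [K * psi]. Inside a window the decrease [G] of that
window may be added; it is at most the difference of the values at its ends,
which the lower bound limits. *)
Lemma rate_upper : \forall n \near \oo, u n <= 5 * K * psi n.
Proof.
have [N1 _ H1] := rate_invariant; have [N2 _ H2] := e_psi.
have [N3 _ H3] := psi_window; have [N4 _ H4] := filterI rate_lower gm_gt0_near.
have [n mn un] := rate_entry (maxn n0 (maxn N1 (maxn N2 (maxn N3 N4)))).
have {mn} [n0n N1n N2n N3n N4n] : [/\ (n0 <= n)%N, (N1 <= n)%N, (N2 <= n)%N,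
   (N3 <= n)%N & (N4 <= n)%N].
  by split; apply: leq_trans mn; rewrite !leq_max leqnn ?orbT.
have orb j : u (orbit n j) <= K * psi (orbit n j).
  elim: j => [//|j IH]; have nj := orbit_ge0 j n0n.
  exact: (H1 _ (leq_trans N1n nj) IH).
exists n => // k /= nk; have [j /andP[jk kj]] := orbit_cover n0n nk.
have nj := orbit_ge0 j n0n; have n0j := leq_trans n0n nj.
have := @window_inside _ k n0j; rewrite jk kj => /(_ isT).
have := window_full n0j; have := orb j.
have := H2 _ (leq_trans N2n nj); have := H3 _ (leq_trans N3n nj).
move=> Hpsi; have := Hpsi k; rewrite jk kj => /(_ isT).
have := (H4 _ (leq_trans N4n (orbit_ge0 j.+1 n0n))).1.
have : psi (orbit n j.+1) <= psi (orbit n j).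
  apply: powRN_le => //; [exact: (H4 _ (leq_trans N4n nj)).2|].
  exact: gm_le (ltnW (next_gt n0j)).
rewrite /orbit /= -/(orbit n j) => m1 lo Hk en un' ufull uin.
have := ler_wpM2l (ltW K_gt0) m1; have := ler_wpM2l (ltW K_gt0) Hk.
have := mulr_ge0 (ltW K_gt0) (powR_ge0 (gm k) (- p)); rewrite -/(psi k).
move: lo; rewrite mulNr; lra.
Qed.

Lemma rate : \forall n \near \oo, `|u n| <= 5 * K * psi n /\ G n <= 7 * K * psi n.
Proof.
have [N1 _ H1] := rate_upper; have [N2 _ H2] := e_psi.
have [N3 _ H3] := gm_gt0_near; have [N4 _ H4] := rate_lower.
exists (maxn n0 (maxn N1 (maxn N2 (maxn N3 N4)))) => // n /= Nn.
have {Nn} [n0n N1n N2n N3n N4n] : [/\ (n0 <= n)%N, (N1 <= n)%N, (N2 <= n)%N,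
   (N3 <= n)%N & (N4 <= n)%N].
  by split; apply: leq_trans Nn; rewrite !leq_max leqnn ?orbT.
have nn := ltnW (next_gt n0n).
have Kpsi : 0 < K * psi n by rewrite mulr_gt0// powR_gt0// H3.
have psi_le : psi (next n) <= psi n by apply: powRN_le => //; [exact: H3|exact: gm_le].
have := H1 n N1n; have := H2 n N2n; have /= := H4 n N4n.
have /= := H4 _ (leq_trans N4n nn).
rewrite !mulNr => lo' lo en up; have := window_full n0n.
have := ler_wpM2l (ltW K_gt0) psi_le.
by split; [rewrite ler_norml; apply/andP; split|]; lra.
Qed.

End rate.

Section rate_constants.
Context (p : R).
Hypothesis u_cvg0 : forall eta : R, 0 < eta -> \forall n \near \oo, `|u n| <= eta.
Hypothesis p_ge0 : 0 <= p.

(** In the borderline case [p * (q - 1) = 1] the target rate is the rate of the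
noiseless recursion itself, and only a large constant is preserved. *)
Lemma rate_bigO (B : R) : 0 <= B -> p * (q - 1) <= 1 ->
  (\forall n \near \oo, e n <= B * gm n `^ (- (p * q))) ->
  exists2 K : R, 0 < K & \forall n \near \oo,
    `|u n| <= K * gm n `^ (- p) /\ G n <= K * gm n `^ (- p).
Proof.
move=> B0 pq1 eB.
(* [D] and [X] are chosen so that [(p + 1) * t <= kappa / 2 * X `^ (q - 1)]
   when [1 < q]. *)
pose D := 2 * ((p + 1) * t) / kappa.
have D0 : 0 <= D by rewrite divr_ge0 ?mulr_ge0 ?addr_ge0// ltW.
pose X := D `^ (q - 1)^-1; have X0 : 0 <= X := powR_ge0 _ _.
have Bk0 : 0 <= 2 * B / kappa by rewrite divr_ge0 ?mulr_ge0// ltW.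
pose K := 2 * (1 + 2 * B / kappa + 2 * B + X).
have K0 : 0 < K by rewrite /K; lra.
have K1 : 1 <= K / 2 by rewrite /K; lra.
have Kgrad : 2 * B <= kappa * (K / 2) `^ q.
  rewrite [leRHS]mulrC -ler_pdivrMr//; apply: (@le_trans _ _ (K / 2)).
    by rewrite /K; lra.
  by rewrite le1r_powR.
have Knoise : B <= K / 4 by rewrite /K; lra.
have Kdrift : \forall n \near \oo,
  (p + 1) * t <= kappa / 2 * (K / 2) `^ (q - 1) * gm n `^ (1 - p * (q - 1)).
  have [pq|pq] := eqVneq (p * (q - 1)) 1.
    apply: nearW => n; rewrite pq subrr powRr0 mulr1.
    have q1 : 0 < q - 1.
      rewrite lt_def subr_ge0 (q_ge1) andbT; apply: contra_eq_neq pq => ->.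
      by rewrite mulr0 eq_sym oner_eq0.
    have : D <= (K / 2) `^ (q - 1).
      have -> : D = X `^ (q - 1) by rewrite /X -powRrM mulVf ?gt_eqF// powRr1.
      apply: ge0_ler_powR; rewrite ?nnegrE//; first exact: ltW.
        by rewrite ltW// divr_gt0.
      by rewrite /K; lra.
    rewrite /D ler_pdivrMr//; lra.
  apply: (powR_gm_unbounded gm_unbounded).
  - by rewrite subr_gt0 lt_neqAle pq.
  - by rewrite mulr_gt0 ?powR_gt0 ?divr_gt0.
  - by rewrite mulr_ge0 ?addr_ge0// ltW.
exists (7 * K); first by rewrite mulr_gt0.
have := rate u_cvg0 p_ge0 B0 eB K0 Kgrad Knoise Kdrift.
apply: filterS => n [un Gn]; split => //; apply: le_trans un _.
by rewrite ler_wpM2r ?powR_ge0//; lra.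
Qed.

Lemma rate_littleo : p * (q - 1) < 1 ->
  (forall B : R, 0 < B -> \forall n \near \oo, e n <= B * gm n `^ (- (p * q))) ->
  forall K : R, 0 < K -> \forall n \near \oo,
    `|u n| <= K * gm n `^ (- p) /\ G n <= K * gm n `^ (- p).
Proof.
move=> pq1 eB K' K'0; pose K := K' / 7; have K0 : 0 < K by rewrite divr_gt0.
pose B := Num.min (K / 4) (kappa * (K / 2) `^ q / 2).
have B0 : 0 < B.
  by rewrite lt_min divr_gt0//= divr_gt0// mulr_gt0// powR_gt0// divr_gt0.
have Kgrad : 2 * B <= kappa * (K / 2) `^ q.
  have : B <= kappa * (K / 2) `^ q / 2 by rewrite ge_min lexx orbT.
  lra.
have Knoise : B <= K / 4 by rewrite ge_min lexx.
have Kdrift : \forall n \near \oo,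
  (p + 1) * t <= kappa / 2 * (K / 2) `^ (q - 1) * gm n `^ (1 - p * (q - 1)).
  apply: (powR_gm_unbounded gm_unbounded).
  - by rewrite subr_gt0.
  - by rewrite mulr_gt0 ?powR_gt0 ?divr_gt0.
  - by rewrite mulr_ge0 ?addr_ge0// ltW.
have := rate u_cvg0 p_ge0 (ltW B0) (eB _ B0) K0 Kgrad Knoise Kdrift.
have -> : K' = 7 * K by rewrite /K; field.
apply: filterS => n [un Gn]; split => //; apply: le_trans un _.
by rewrite ler_wpM2r ?powR_ge0//; lra.
Qed.

End rate_constants.
End scalar.

(** * Accumulation points of a bounded trajectory *)

Section accumulation.
Context (R : realType) (d : nat) (x : nat -> 'rV[R]_d) (b : R).
Hypothesis x_ball : forall n, enorm (x n) <= b.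

Lemma A_hat_near (z : 'rV[R]_d) (e : R) (m : nat) :
  A_hat x z -> 0 < e -> exists2 n, (m <= n)%N & enorm (x n - z) < e.
Proof.
move=> Az e0.
have xm : (x @ \oo) [set y | exists2 n, (m <= n)%N & x n = y].
  by exists m => // n /= mn; exists n.
by have [_ [[n mn <-] xz]] := Az _ _ xm (near_enorm_lt z e0); exists n.
Qed.

Lemma A_hat_ball (z : 'rV[R]_d) : A_hat x z -> enorm z <= b.
Proof.
move=> Az; apply/ler_addgt0Pr => e e0.
have [n _ xz] := A_hat_near 0 Az e0.
apply: le_trans (enorm_le_sub z (x n)) _; rewrite enormB lerD// ltW//.
Qed.

(** By compactness, the points of the ball that are not accumulation points are
covered by finitely many neighbourhoods which the trajectory leaves for good;
from then on it only visits places where the property near accumulation points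
is known. *)
Lemma near_A_hat (I : Type) (F : set_system I) {FF : Filter F}
    (P : I -> 'rV[R]_d -> Prop) :
  (forall z, A_hat x z -> \forall y \near z & i \near F, P i y) ->
  \forall n \near \oo & i \near F, P i (x n).
Proof.
move=> HP.
have := (@compact_near_coveringP _ _).1 (@compact_enorm_ball R d b).
move=> /(_ _ (@filter_prod nat I \oo F) (fun ni y => y = x ni.1 -> P ni.2 y) _) H.
apply: filterS (H _) => [[n i] /= Hn|z zb].
  exact: (Hn (x n) (x_ball n) erefl).
have [Az|nAz] := pselect (A_hat x z).
  have [[U J] [/= Uz FJ] UJ] := HP z Az.
  exists (U, [set ni | J ni.2]) => /=.
    split => //; exists (setT, J); last by move=> [n i] [].
    by split => //=; exact: filterT.
  by move=> [y [n i]] [/= Uy Ji] _; exact: (UJ (y, i)).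
have [V Vz [N HN]] : exists2 V, nbhs z V & exists N, forall n, (N <= n)%N -> ~ V (x n).
  apply: contrapT => noV; apply: nAz => A B [N _ AN] Bz.
  apply: contrapT => AB; apply: noV; exists B => //; exists N => n Nn Bx.
  by apply: AB; exists (x n); split => //; exact: AN.
exists (V, [set ni | (N <= ni.1)%N]) => /=.
  split => //; exists ([set n | (N <= n)%N], setT); last by move=> [n i] [].
  by split; [exists N|exact: filterT].
by move=> [y [n i]] [/= Vy Nn] yx; case: (HN n Nn); rewrite -yx.
Qed.

Section neighbourhood.
Context (rho0 : R).
Hypothesis rho0_gt0 : 0 < rho0.

Let Q := [set y | (setdist (@enorm R d) (A_hat x) y <= rho0%:E)%E].

Lemma setdist_le (A : set 'rV[R]_d) (y z : 'rV[R]_d) :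
  A z -> (setdist (@enorm R d) A y <= (enorm (y - z))%:E)%E.
Proof. by move=> Az; apply: ereal_inf_lbound; exists z. Qed.

Lemma setdist_approx (y : 'rV[R]_d) (e : R) : Q y -> 0 < e ->
  exists2 z, A_hat x z & enorm (y - z) < rho0 + e.
Proof.
move=> Qy e0.
have : (setdist (@enorm R d) (A_hat x) y < (rho0 + e)%:E)%E.
  by apply: le_lt_trans Qy _; rewrite lte_fin ltrDl.
by move=> /ereal_inf_lt[_ [z Az <-]]; rewrite lte_fin; exists z.
Qed.

Lemma compact_neighbourhood_A_hat : compact Q.
Proof.
apply: bounded_closed_compact.
  apply: (@enorm_bounded_set _ _ _ (b + (rho0 + 1))) => y Qy.
  have [z Az yz] := setdist_approx Qy ltr01.
  by apply: le_trans (enorm_le_sub y z) _; rewrite lerD ?A_hat_ball// ltW.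
move=> y cy; apply/lee_addgt0Pr => e e0; have e20 : 0 < e / 2 by rewrite divr_gt0.
have [y' [Qy' yy']] := cy _ (near_enorm_lt y e20).
have [z Az yz] := setdist_approx Qy' e20.
apply: le_trans (setdist_le _ Az) _; rewrite -EFinD lee_fin.
have := enormD (y - y') (y' - z); rewrite subrKA (enormB y y').
move: yy' => /=; lra.
Qed.

Lemma near_neighbourhood_A_hat : \forall n \near \oo, Q (x n).
Proof.
have H z : A_hat x z -> \forall y \near z & i \near (\oo : set_system nat), Q y.
  move=> Az; exists ([set y | enorm (y - z) < rho0], setT) => /=.
    by split; [exact: near_enorm_lt|exact: filterT].
  move=> [y n] [/= yz _]; apply: le_trans (setdist_le _ Az) _.
  by rewrite lee_fin ltW.
have [[U J] [/= UN [m _ mJ]] UJ] := near_A_hat H.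
by apply: filterS UN => n Un; apply: (UJ (n, m)); split; [exact: Un|apply: mJ => /=].
Qed.

End neighbourhood.

Section liminf.
Context (f : 'rV[R]_d -> R).
Hypothesis f_cont : continuous f.

Let u n := (f (x n))%:E.

Lemma f_hat_fin : (f_hat f x)%:E = limn_einf u.
Proof.
rewrite /f_hat fineK//.
have : bounded_set (f @` [set y | enorm y <= b]).
  apply: compact_bounded; apply: continuous_compact (@compact_enorm_ball R d b).
  exact: continuous_subspaceT.
move=> [M [_ HM]]; have {HM} fM n : `|f (x n)| <= M + 1.
  by apply: (HM (M + 1)); [rewrite ltrDl|exists (x n) => //=].
have lo : ((- (M + 1))%:E <= limn_einf u)%E.
  rewrite /limn_einf -[X in (_ <= X)%E]/(limf_einf u \oo) limf_einfE.
  apply: le_trans (ereal_sup_ubound _); last by exists setT => //; exact: filterT.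
  apply: le_ereal_inf_tmp => _ [n _ <-]; rewrite lee_fin.
  by have := fM n; rewrite ler_norml => /andP[].
have hi : (limn_einf u <= (M + 1)%:E)%E.
  rewrite /limn_einf -[X in (X <= _)%E]/(limf_einf u \oo) limf_einfE.
  apply: ge_ereal_sup => _ [V [m _ mV] <-].
  apply: le_trans (ereal_inf_lbound _) (_ : u m <= _)%E.
    by exists m => //; apply: mV => /=.
  by rewrite lee_fin; have := fM m; rewrite ler_norml => /andP[].
by rewrite fin_numE; apply/andP; split; apply/eqP => E; move: lo hi; rewrite E.
Qed.

Lemma f_hat_lower (eta : R) : 0 < eta ->
  \forall n \near \oo, - eta <= f (x n) - f_hat f x.
Proof.
move=> eta0.
have : ((f_hat f x - eta)%:E < limf_einf u \oo)%E.
  by rewrite -[limf_einf _ _]/(limn_einf u) -f_hat_fin lte_fin ltrBlDr ltrDl.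
rewrite limf_einfE => /ereal_sup_gt[_ [V oV <-]] infV.
apply: filterS oV => n Vn.
have : ((f_hat f x - eta)%:E < u n)%E.
  by apply: lt_le_trans infV _; apply: ereal_inf_lbound; exists n.
rewrite lte_fin; lra.
Qed.

Lemma f_hat_recurrent (eta : R) (m : nat) : 0 < eta ->
  exists2 n, (m <= n)%N & f (x n) - f_hat f x <= eta.
Proof.
move=> eta0; apply: contrapT => H.
have : (limf_einf u \oo < (f_hat f x + eta)%:E)%E.
  by rewrite -[limf_einf _ _]/(limn_einf u) -f_hat_fin lte_fin ltrDl.
rewrite ltNge => /negP; apply; rewrite limf_einfE.
apply: le_trans (ereal_sup_ubound _); last first.
  by exists [set n | (m <= n)%N] => //; exists m.
apply: le_ereal_inf_tmp => _ [n /= mn <-]; rewrite lee_fin leNgt; apply/negP => fn.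
by apply: H; exists n => //; lra.
Qed.

(** If [f] differed from its lower limit at every accumulation point, it would
eventually stay away from it along the trajectory. *)
Lemma f_hat_attained : exists2 z, A_hat x z & f z = f_hat f x.
Proof.
apply: contrapT => H.
have away z : A_hat x z -> \forall y \near z & e \near 0^'+, e <= `|f y - f_hat f x|.
  move=> Az; have fz : 0 < `|f z - f_hat f x| / 2.
    rewrite divr_gt0// normr_gt0 subr_eq0; apply/eqP => fz; apply: H; exists z => //.
  exists ([set y | `|f z - f y| < `|f z - f_hat f x| / 2],
          [set e | e <= `|f z - f_hat f x| / 2]) => /=.
    split; last exact: nbhs_right_le.
    by have := @f_cont z => /(@cvgrPdist_lt _ R _ _ (nbhs_filter z))/(_ _ fz).
  move=> [y e] [/= fy ee]; apply: le_trans ee _.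
  have := ler_normD (f z - f y) (f y - f_hat f x); rewrite subrKA; lra.
have [[U J] [/= [N _ NU] Je] UJ] := near_A_hat away.
have [e [Je' e0]] := filter_ex (filterI Je (nbhs_right_gt 0)).
have [M _ HM] := f_hat_lower (divr_gt0 e0 (ltr0Sn _ 1)).
have [n] := f_hat_recurrent (maxn N M) (divr_gt0 e0 (ltr0Sn _ 1)).
rewrite geq_max => /andP[Nn Mn] up; have lo := HM n Mn.
have : e <= `|f (x n) - f_hat f x| by apply: (UJ (n, e)); split => //; exact: NU.
rewrite leNgt => /negP; apply; apply: (@le_lt_trans _ _ (e / 2)); last by move: e0 => /=; lra.
by rewrite ler_norml lo up.
Qed.

End liminf.
End accumulation.

(** * Rates along one bounded trajectory *)

Section trajectory.
Context (R : realType) (d : nat) (f : 'rV[R]_d -> R) (alpha : nat -> R)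
  (x v : nat -> 'rV[R]_d) (r b L : R).
Hypothesis f_diff : forall z, differentiable f z.
Hypothesis alpha_gt0 : forall n, 0 < alpha n.
Hypothesis alpha_cvg0 : alpha n @[n --> \oo] --> 0.
Hypothesis alpha_sum : (\sum_(0 <= n <oo) (alpha n)%:E)%E = +oo%E.
Hypothesis recursion : forall n, x n.+1 = x n - alpha n *: (grad f (x n) + v n).
Hypothesis r_gt0 : 0 < r.
Hypothesis noise_fin : (noise_limsup alpha r v < +oo)%E.
Hypothesis x_ball : forall n, enorm (x n) <= b.
Hypothesis L_ge1 : 1 <= L.
Hypothesis grad_lip : forall y z, enorm y <= b -> enorm z <= b ->
  enorm (grad f y - grad f z) <= L * enorm (y - z).

Context (Q : set 'rV[R]_d) (fhat delta mu M : R).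
Hypothesis x_Q : \forall n \near \oo, Q (x n).
Hypothesis fhat_lower : forall eta : R, 0 < eta ->
  \forall n \near \oo, - eta <= f (x n) - fhat.
Hypothesis fhat_rec : forall (eta : R) m, 0 < eta ->
  exists2 n, (m <= n)%N & f (x n) - fhat <= eta.
Hypothesis delta_gt0 : 0 < delta.
Hypothesis mu_range : 1 < mu <= 2.
Hypothesis M_ge1 : 1 <= M.
Hypothesis value_ineq : forall y, Q y -> `|f y - fhat| <= delta ->
  `|f y - fhat| <= M * enorm (grad f y) `^ mu.

(* The largest window length allowed by [window_descent]. *)
Let t := (40 * L)^-1.
Let next n := aidx alpha n t.
Let u n := f (x n) - fhat.
Let G n := t / 4 * enorm (grad f (x n)) ^+ 2.
Let e n := (8 / t + 8 * L) * window_noise alpha v n ^+ 2.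
Let kappa := t / 4 * M^-1 `^ (2 / mu).

Let L_gt0 : 0 < L. Proof. exact: lt_le_trans ltr01 L_ge1. Qed.

Let t_gt0 : 0 < t. Proof. by rewrite invr_gt0 mulr_gt0. Qed.

Let Lt : 40 * L * t <= 1. Proof. by rewrite divff// gt_eqF// mulr_gt0. Qed.

Let t_le1 : t <= 1.
Proof. rewrite invf_le1 ?mulr_gt0//; have := L_ge1; lra. Qed.

Let mu_gt0 : 0 < mu. Proof. by have /andP[+ _] := mu_range; apply: lt_trans. Qed.

Let M_gt0 : 0 < M. Proof. exact: lt_le_trans ltr01 M_ge1. Qed.

Let kappa_gt0 : 0 < kappa.
Proof.
by apply: mulr_gt0; [rewrite divr_gt0|rewrite powR_gt0 ?invr_gt0 ?M_gt0].
Qed.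

Let q_ge1 : 1 <= 2 / mu.
Proof. by rewrite ler_pdivlMr// mul1r; have /andP[] := mu_range. Qed.

Let G_ge0 n : 0 <= G n.
Proof. by rewrite mulr_ge0 ?sqr_ge0// divr_ge0// ltW. Qed.

Let gm_unbounded A : \forall n \near \oo, A <= gam alpha n.
Proof. exact: gam_ge_near. Qed.

Let noise n k : (n <= k <= next n)%N ->
  enorm (\sum_(n <= i < k) alpha i *: v i) <= window_noise alpha v n.
Proof.
move=> /andP[nk kn]; apply: window_noise_ge; rewrite nk (leq_trans kn)//.
exact: aidx_le.
Qed.

Let next_spec n : [/\ (n <= next n)%N & gam alpha (next n) - gam alpha n <= t].
Proof. by have [] := aidxP alpha_gt0 alpha_sum n t_gt0. Qed.

(** The hypotheses on abstract descending sequences hold for the trajectory. The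
last one is the inequality between value and gradient raised to the power
[2 / mu], which makes the squared gradient appear. *)
Lemma near_window_facts : exists n0, [/\
  forall n, (n0 <= n)%N -> (n < next n)%N,
  forall n, (n0 <= n)%N -> gam alpha (next n) <= gam alpha n + t,
  forall n, (n0 <= n)%N -> u (next n) <= u n - G n + e n,
  forall n k, (n0 <= n)%N -> (n <= k <= next n)%N -> u k <= u n + G n + e n &
  forall n, (n0 <= n)%N -> `|u n| <= delta -> kappa * `|u n| `^ (2 / mu) <= G n].
Proof.
have [n0 _ H] := filterI x_Q (aidx_progress alpha_gt0 alpha_cvg0 alpha_sum t_gt0).
exists n0; split=> n.
- move=> /H[_ nn]; apply: (gam_lt_inv alpha_gt0); apply: lt_le_trans nn.
  by rewrite ltrDl divr_gt0.
- by move=> _; have [_] := next_spec n; rewrite lerBlDl.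
- move=> /H[_ nn]; have [nK Kt] := next_spec n.
  have := @window_descent_full R d f alpha x v b L f_diff alpha_gt0 recursion
    x_ball L_ge1 grad_lip n (next n) t _ Lt Kt (@noise n) nK t_gt0.
  rewrite lerBrDl => /(_ nn); rewrite /u /G /e; lra.
- move=> k _ nk; have [nK Kt] := next_spec n.
  have := @window_descent_inside R d f alpha x v b L f_diff alpha_gt0 recursion
    x_ball L_ge1 grad_lip n (next n) t _ Lt Kt (@noise n) nK k t_gt0 nk.
  rewrite /u /G /e; lra.
- move=> /H[Qx _] /(value_ineq Qx) ineq.
  rewrite /kappa /G -mulrA ler_pM2l ?divr_gt0//.
  rewrite -powRM ?normr_ge0 ?invr_ge0 ?(ltW M_gt0)//.
  have -> : enorm (grad f (x n)) ^+ 2 = (enorm (grad f (x n)) `^ mu) `^ (2 / mu).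
    by rewrite -powRrM mulrCA divff ?mulr1 ?gt_eqF// -powR_mulrn ?enorm_ge0.
  apply: (ge0_ler_powR (le_trans ler01 q_ge1)).
  - by rewrite nnegrE mulr_ge0 ?invr_ge0 ?(ltW M_gt0).
  - by rewrite nnegrE powR_ge0.
  by rewrite ler_pdivrMl.
Qed.

Let window_noise_ge0 n : 0 <= window_noise alpha v n.
Proof. exact: bigmax_ge_id. Qed.

Let c_gt0 : 0 < 8 / t + 8 * L.
Proof. by rewrite addr_gt0 ?divr_gt0 ?mulr_gt0. Qed.

Let e_le (c p : R) : (noise_limsup alpha r v < c%:E)%E -> p <= 2 * r ->
  \forall n \near \oo, e n <= (8 / t + 8 * L) * c ^+ 2 * gam alpha n `^ (- p).
Proof.
move=> nc p2r; near=> n.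
have g1 : 1 <= gam alpha n by near: n; exact: gm_unbounded.
rewrite /e -mulrA ler_pM2l//.
have wn : window_noise alpha v n <= c * gam alpha n `^ (- r).
  by near: n; apply: noise_window_bound => //; exact: ltW.
apply: (@le_trans _ _ ((c * gam alpha n `^ (- r)) ^+ 2)).
  by rewrite ler_pXn2r ?nnegrE// (le_trans _ wn).
rewrite exprMn ler_wpM2l ?sqr_ge0// -powR_mulrn ?powR_ge0// -powRrM.
by apply: ler_powR => //; lra.
Unshelve. all: by end_near. Qed.

Let noise_bound : exists c : R, (noise_limsup alpha r v < c%:E)%E.
Proof.
move: noise_fin; case: (noise_limsup _ _ _) => [c _| //|_].
  by exists (c + 1); rewrite lte_fin ltrDl.
by exists 0; rewrite ltNyr.
Qed.

Lemma trajectory_value_cvg (eta : R) : 0 < eta ->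
  \forall n \near \oo, `|f (x n) - fhat| <= eta.
Proof.
have [n0 [H1 H2 H3 H4 H5]] := near_window_facts.
apply: (@cvg_of_descent R u G e next n0 delta kappa (2 / mu)) => //.
  move=> eta' eta'0; have [c nc] := noise_bound; near=> n.
  apply: (@le_trans _ _ ((8 / t + 8 * L) * c ^+ 2 * gam alpha n `^ (- (2 * r)))).
    by near: n; exact: e_le.
  near: n; apply: powRN_gm_small => //; first by rewrite mulr_gt0.
  by rewrite mulr_ge0 ?sqr_ge0// ltW.
by move=> eta' eta'0 m; exact: fhat_rec.
Unshelve. all: by end_near. Qed.

Context (m : R).
Hypothesis m_gt0 : 0 < m.
Hypothesis m_le_r : m <= r.

(* The two products of exponents on which the rate depends: the first is compared
   with the exponent [2 * r] of the squared noise, the second with 1. *)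
Let pq : mu * m * (2 / mu) = 2 * m.
Proof. by field; rewrite gt_eqF. Qed.

Let pq1 : mu * m * (2 / mu - 1) = m * (2 - mu).
Proof. by field; rewrite gt_eqF. Qed.

Let p_ge0 : 0 <= mu * m. Proof. by rewrite mulr_ge0// ltW. Qed.

Let grad_of_G (K : R) n : G n <= t / 4 * K * gam alpha n `^ (- (mu * m)) ->
  enorm (grad f (x n)) ^+ 2 <= K * gam alpha n `^ (- (mu * m)).
Proof. by rewrite /G -[t / 4 * K * _]mulrA ler_pM2l ?divr_gt0. Qed.

Lemma trajectory_bigO : m * (2 - mu) <= 1 ->
  exists2 K : R, 0 < K & \forall n \near \oo,
    `|f (x n) - fhat| <= K * gam alpha n `^ (- (mu * m)) /\
    enorm (grad f (x n)) ^+ 2 <= K * gam alpha n `^ (- (mu * m)).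
Proof.
move=> mmu; have [n0 [H1 H2 H3 H4 H5]] := near_window_facts.
have [c nc] := noise_bound.
have [|||K K0 HK] := @rate_bigO R (gam alpha) u G e next n0 t delta kappa (2 / mu)
  t_gt0 (gam_le alpha_gt0) gm_unbounded H1 H2 G_ge0 H3 H4 delta_gt0 kappa_gt0 q_ge1
  H5 (mu * m) trajectory_value_cvg p_ge0 ((8 / t + 8 * L) * c ^+ 2).
- by rewrite mulr_ge0 ?sqr_ge0// ltW.
- by rewrite pq1.
- by rewrite pq; apply: e_le => //; rewrite ler_pM2l.
exists (K / (t / 4)); first by rewrite !divr_gt0.
apply: filterS HK => n [un Gn]; split.
  apply: le_trans un _; rewrite ler_wpM2r ?powR_ge0// ler_pdivlMr ?divr_gt0//.
  by rewrite ler_piMr ?(ltW K0)//; have := t_le1; lra.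
by apply: grad_of_G; rewrite mulrCA divff ?mulr1// gt_eqF ?divr_gt0.
Qed.

Lemma trajectory_littleo : noise_limsup alpha r v = 0%E -> m * (2 - mu) < 1 ->
  forall K : R, 0 < K -> \forall n \near \oo,
    `|f (x n) - fhat| <= K * gam alpha n `^ (- (mu * m)) /\
    enorm (grad f (x n)) ^+ 2 <= K * gam alpha n `^ (- (mu * m)).
Proof.
move=> noise0 mmu K K0; have [n0 [H1 H2 H3 H4 H5]] := near_window_facts.
have := @rate_littleo R (gam alpha) u G e next n0 t delta kappa (2 / mu)
  t_gt0 (gam_le alpha_gt0) gm_unbounded H1 H2 G_ge0 H3 H4 delta_gt0 kappa_gt0 q_ge1
  H5 (mu * m) trajectory_value_cvg p_ge0.
rewrite pq1 pq => /(_ mmu) H; apply: filterS (H _ (t / 4 * K) _) => [n [un Gn]|B B0|].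
- split; last exact: grad_of_G.
  apply: le_trans un _; rewrite ler_wpM2r ?powR_ge0// ler_piMl ?(ltW K0)//.
  by have := t_le1; lra.
- have C0 := c_gt0; set C := 8 / t + 8 * L in C0.
  have c0 : 0 < Num.sqrt (B / C) by rewrite sqrtr_gt0 divr_gt0.
  have -> : B = C * Num.sqrt (B / C) ^+ 2.
    rewrite sqr_sqrtr; last by rewrite divr_ge0 ?(ltW B0) ?(ltW C0).
    by rewrite mulrCA divff ?mulr1// gt_eqF.
  by apply: e_le; rewrite ?noise0 ?lte_fin// ler_pM2l.
- by rewrite mulr_gt0// divr_gt0.
Qed.

End trajectory.

(** * From one trajectory to the theorem *)

Lemma bounded_seq_ball (R : realType) (d : nat) (x : nat -> 'rV[R]_d) :
  bounded_seq x -> exists b, forall n, enorm (x n) <= b.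
Proof.
rewrite /bounded_seq; set s := ereal_sup _ => sy.
have xs n : ((enorm (x n))%:E <= s)%E by apply: ereal_sup_ubound; exists n.
case: s sy xs => [b _ xb|//|_ xs]; last by have := xs 0%N.
by exists b => n; rewrite -lee_fin.
Qed.

Lemma fine_setdist_bound (R : realType) (U : zmodType) (N : U -> R) (A : set U)
    (y : U) (c : R) :
  (forall z, 0 <= N z) -> (setdist N A y <= c%:E)%E ->
  `|fine (setdist N A y)| <= c.
Proof.
move=> N0 le_c.
have ge0 : (0 <= setdist N A y)%E.
  by apply: le_ereal_inf_tmp => _ [z _ <-]; rewrite lee_fin.
have fin : setdist N A y \is a fin_num.
  by rewrite ge0_fin_numE// (le_lt_trans le_c)// ltry.
by rewrite ger0_norm ?fine_ge0// -lee_fin fineK.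
Qed.

(** The product [m * (2 - mu)] is 0 for [mu = 2]; otherwise it reaches 1 only for
[m = 1 / (2 - mu)], which [r < rhat] excludes. *)
Lemma min_rate (R : realType) (mu r : R) :
  0 < r -> 1 < mu <= 2 ->
  let rhat : \bar R := if mu < 2 then ((2 - mu)^-1)%:E else +oo%E in
  let m := fine (Order.min r%:E rhat) in
  [/\ 0 < m, m <= r, m * (2 - mu) <= 1 & (r%:E < rhat)%E -> m * (2 - mu) < 1].
Proof.
move=> r0 /andP[mu1 mu2] rhat m; rewrite /m /rhat.
have [mu_lt|mu_ge] := ltP mu 2; last first.
  have -> : mu = 2 by apply/eqP; rewrite eq_le mu2.
  by rewrite min_l ?leey//= subrr mulr0 ltr01 ler01; split.
have s0 : 0 < 2 - mu by rewrite subr_gt0.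
rewrite -EFin_min/=; split.
- by rewrite lt_min r0 invr_gt0.
- by rewrite ge_min lexx.
- by rewrite -ler_pdivlMr// mul1r ge_min lexx orbT.
- rewrite lte_fin => rs; rewrite min_l ?ltW//.
  by rewrite -ltr_pdivlMr// mul1r.
Qed.

Section pathwise.
Context (R : realType) (d : nat) (f : 'rV[R]_d -> R) (alpha : nat -> R)
  (x v : nat -> 'rV[R]_d) (r rho0 : R)
  (delta mu M : set 'rV[R]_d -> R -> R) (nu N : set 'rV[R]_d -> R).
Hypothesis f_diff : forall z, differentiable f z.
Hypothesis grad_lip : locally_lipschitz (grad f).
Hypothesis alpha_gt0 : forall n, 0 < alpha n.
Hypothesis alpha_cvg0 : alpha n @[n --> \oo] --> 0.
Hypothesis alpha_sum : (\sum_(0 <= n <oo) (alpha n)%:E)%E = +oo%E.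
Hypothesis recursion : forall n, x n.+1 = x n - alpha n *: (grad f (x n) + v n).
Hypothesis r_gt0 : 0 < r.
Hypothesis noise_fin : (noise_limsup alpha r v < +oo)%E.
Hypothesis x_bounded : bounded_seq x.
Hypothesis value_ineq : forall (Q : set 'rV[R]_d) (a : R),
  compact Q -> (f @` Q) a ->
  [/\ 0 < delta Q a < 1, 1 < mu Q a <= 2, 1 <= M Q a &
    forall x, Q x -> `|f x - a| <= delta Q a ->
      `|f x - a| <= M Q a * enorm (grad f x) `^ mu Q a].
Hypothesis dist_ineq : forall Q : set 'rV[R]_d, compact Q ->
  [/\ 0 < nu Q <= 1, 1 <= N Q &
    forall x, Q x -> (setdist (@enorm R d) (crit_points f) x <=
      (N Q * enorm (grad f x) `^ nu Q)%:E)%E].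
Hypothesis rho0_gt0 : 0 < rho0.

Let Q := Q_hat x rho0.
Let fhat := f_hat f x.
Let phat := p_hat f x rho0 mu r.
Let qhat := q_hat f x rho0 mu nu r.
Let gm := gam alpha.
Let m := fine (Order.min r%:E (r_hat f x rho0 mu)).

Let Q_E : Q = [set y | (setdist (@enorm R d) (A_hat x) y <= rho0%:E)%E].
Proof. by rewrite /Q /Q_hat asboolT. Qed.

Let mu_hatE : mu_hat f x rho0 mu = mu Q fhat.
Proof. by rewrite /mu_hat asboolT. Qed.

Let phatE : phat = mu Q fhat * m.
Proof. by rewrite /phat /p_hat mu_hatE. Qed.

Let qhatE : qhat = phat * (nu Q / 2).
Proof. by rewrite phatE /qhat /q_hat /nu_hat asboolT// -/Q -/fhat -/m; ring. Qed.

Let f_cont : continuous f.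
Proof. by move=> z; exact: differentiable_continuous. Qed.

Let trajectory_facts : exists b L, [/\ forall n, enorm (x n) <= b, 1 <= L,
  forall y z, enorm y <= b -> enorm z <= b ->
    enorm (grad f y - grad f z) <= L * enorm (y - z),
  compact Q & \forall n \near \oo, Q (x n)].
Proof.
have [b xb] := bounded_seq_ball x_bounded.
have [L L1 HL] := locally_lipschitz_compact grad_lip (@compact_enorm_ball R d b).
exists b, L; split=> //; rewrite Q_E.
- exact: (compact_neighbourhood_A_hat xb).
- exact: (near_neighbourhood_A_hat xb).
Qed.

Let fhat_Q : (f @` Q) fhat.
Proof.
have [b [L [xb _ _ _ _]]] := trajectory_facts.
have [z Az fz] := f_hat_attained xb f_cont.
exists z => //; rewrite Q_E; apply: le_trans (setdist_le _ Az) _.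
by rewrite subrr enorm0 lee_fin ltW.
Qed.

Let exponents : [/\ 0 < m, m <= r, m * (2 - mu Q fhat) <= 1 &
  (r%:E < r_hat f x rho0 mu)%E -> m * (2 - mu Q fhat) < 1].
Proof.
have [b [L [_ _ _ cQ _]]] := trajectory_facts.
have [_ mu_range _ _] := value_ineq cQ fhat_Q.
have := min_rate r_gt0 mu_range; rewrite /m /r_hat mu_hatE; exact.
Qed.

Let phat_gt0 : 0 < phat.
Proof.
have [b [L [_ _ _ cQ _]]] := trajectory_facts.
have [_ /andP[mu1 _] _ _] := value_ineq cQ fhat_Q.
have [m0 _ _ _] := exponents.
by rewrite phatE mulr_gt0// (lt_trans ltr01).
Qed.

Lemma pathwise_value_gradient_bigO : exists2 K : R, 0 < K &
  \forall n \near \oo, `|f (x n) - fhat| <= K * gm n `^ (- phat) /\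
    enorm (grad f (x n)) ^+ 2 <= K * gm n `^ (- phat).
Proof.
have [b [L [xb L1 HL cQ xQ]]] := trajectory_facts.
have [/andP[delta0 _] mu_range M1 ineq] := value_ineq cQ fhat_Q.
have [m0 mr mmu _] := exponents.
rewrite phatE; exact: (trajectory_bigO f_diff alpha_gt0 alpha_cvg0 alpha_sum recursion
  r_gt0 noise_fin xb L1 HL xQ (f_hat_lower xb f_cont) (f_hat_recurrent xb f_cont)
  delta0 mu_range M1 ineq m0 mr mmu).
Qed.

Lemma pathwise_value_gradient_littleo :
  noise_limsup alpha r v = 0%E -> (r%:E < r_hat f x rho0 mu)%E ->
  forall K : R, 0 < K ->
  \forall n \near \oo, `|f (x n) - fhat| <= K * gm n `^ (- phat) /\
    enorm (grad f (x n)) ^+ 2 <= K * gm n `^ (- phat).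
Proof.
move=> noise0 rr.
have [b [L [xb L1 HL cQ xQ]]] := trajectory_facts.
have [/andP[delta0 _] mu_range M1 ineq] := value_ineq cQ fhat_Q.
have [m0 mr _ /(_ rr) mmu] := exponents.
rewrite phatE; exact: (trajectory_littleo f_diff alpha_gt0 alpha_cvg0 alpha_sum recursion
  r_gt0 noise_fin xb L1 HL xQ (f_hat_lower xb f_cont) (f_hat_recurrent xb f_cont)
  delta0 mu_range M1 ineq m0 mr noise0 mmu).
Qed.

(** The gradient tends to 0 along the trajectory, hence vanishes at an
accumulation point where [f] takes its limit value. *)
Let fhat_critical : crit_values f fhat.
Proof.
have [b [L [xb L1 HL _ _]]] := trajectory_facts.
have [K K0 HK] := pathwise_value_gradient_bigO.
have [z Az fz] := f_hat_attained xb f_cont; exists z => //.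
have L0 : 0 < L by exact: lt_le_trans L1.
apply: enorm_eq0; apply/eqP; rewrite eq_le enorm_ge0 andbT.
apply/ler_addgt0Pr => e e0; rewrite add0r.
have e2 : 0 < e / 2 by rewrite divr_gt0.
have [n0 _ H] := filterI HK (powRN_gm_small (gam_ge_near alpha_gt0 alpha_sum)
  phat_gt0 (ltW K0) (exprn_gt0 2 e2)).
have [n n0n xz] := A_hat_near n0 Az (divr_gt0 e2 L0).
have [[_ gn] small] := H n n0n.
have ge : enorm (grad f (x n)) <= e / 2.
  by rewrite -(@ler_pXn2r _ 2) ?nnegrE ?enorm_ge0 ?(ltW e2)//; exact: le_trans gn small.
have := HL _ _ (A_hat_ball xb Az) (xb n).
have := enorm_le_sub (grad f z) (grad f (x n)).
rewrite (enormB z); have : L * enorm (x n - z) <= e / 2.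
  by rewrite mulrC -ler_pdivlMr// ltW.
lra.
Qed.

Let value_dist_le n :
  `|fine (setdist Num.norm (crit_values f) (f (x n)))| <= `|f (x n) - fhat|.
Proof.
apply: fine_setdist_bound => [z|]; first exact: normr_ge0.
by apply: ereal_inf_lbound; exists fhat.
Qed.

Let point_dist_le (K : R) : 0 <= K -> \forall n \near \oo,
  enorm (grad f (x n)) ^+ 2 <= K * gm n `^ (- phat) ->
  `|fine (setdist (@enorm R d) (crit_points f) (x n))|
    <= N Q * K `^ (nu Q / 2) * gm n `^ (- qhat).
Proof.
move=> K0; have [b [L [_ _ _ cQ xQ]]] := trajectory_facts.
have [/andP[nu0 _] N1 ineq] := dist_ineq cQ.
apply: filterS xQ => n Qn gn; apply: fine_setdist_bound => [z|].
  exact: enorm_ge0.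
apply: le_trans (ineq _ Qn) _; rewrite lee_fin -mulrA.
apply: ler_wpM2l; first exact: le_trans ler01 N1.
have -> : enorm (grad f (x n)) `^ nu Q = (enorm (grad f (x n)) ^+ 2) `^ (nu Q / 2).
  by rewrite -powR_mulrn ?enorm_ge0// -powRrM; congr (_ `^ _); field.
rewrite qhatE -mulNr [gm n `^ _]powRrM -powRM ?powR_ge0//.
apply: ge0_ler_powR => //.
- by rewrite divr_ge0// ltW.
- by rewrite nnegrE sqr_ge0.
- by rewrite nnegrE mulr_ge0 ?powR_ge0.
Qed.

Lemma pathwise_bigO :
  [/\ (fun n => enorm (grad f (x n)) ^+ 2) =O_\oo (fun n => gm n `^ (- phat)),
      (fun n => fine (setdist Num.norm (crit_values f) (f (x n))))
        =O_\oo (fun n => gm n `^ (- phat)) &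
      (fun n => fine (setdist (@enorm R d) (crit_points f) (x n)))
        =O_\oo (fun n => gm n `^ (- qhat))].
Proof.
have [K K0 HK] := pathwise_value_gradient_bigO.
have [b [L [_ _ _ cQ _]]] := trajectory_facts.
have [_ N1 _] := dist_ineq cQ; have N0 := lt_le_trans ltr01 N1.
split; apply/eqO_exP.
- exists K => //; apply: filterS HK => n [_ gn].
  by rewrite !ger0_norm ?powR_ge0 ?sqr_ge0.
- exists K => //; apply: filterS HK => n [un _].
  by rewrite [X in K * X]ger0_norm ?powR_ge0//; exact: le_trans (value_dist_le n) un.
- exists (N Q * K `^ (nu Q / 2)); first by rewrite mulr_gt0 ?powR_gt0.
  apply: filterS2 HK (point_dist_le (ltW K0)) => n [_ gn] /(_ gn).
  by rewrite [X in _ -> _ <= _ * X]ger0_norm ?powR_ge0.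
Qed.

Lemma pathwise_littleo :
  noise_limsup alpha r v = 0%E -> (r%:E < r_hat f x rho0 mu)%E ->
  [/\ (fun n => enorm (grad f (x n)) ^+ 2) =o_\oo (fun n => gm n `^ (- phat)),
      (fun n => fine (setdist Num.norm (crit_values f) (f (x n))))
        =o_\oo (fun n => gm n `^ (- phat)) &
      (fun n => fine (setdist (@enorm R d) (crit_points f) (x n)))
        =o_\oo (fun n => gm n `^ (- qhat))].
Proof.
move=> noise0 rr; have H := pathwise_value_gradient_littleo noise0 rr.
have [b [L [_ _ _ cQ _]]] := trajectory_facts.
have [/andP[nu0 _] N1 _] := dist_ineq cQ; have N0 := lt_le_trans ltr01 N1.
split; apply/eqoP => e e0.
- apply: filterS (H e e0) => n [_ gn].
  by rewrite !ger0_norm ?powR_ge0 ?sqr_ge0.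
- apply: filterS (H e e0) => n [un _].
  by rewrite [X in e * X]ger0_norm ?powR_ge0//; exact: le_trans (value_dist_le n) un.
(* [K] is the constant for the squared gradient that yields [e] for the distance. *)
- pose K := (e / N Q) `^ (2 / nu Q).
  have K0 : 0 < K by rewrite powR_gt0// divr_gt0.
  have eK : e = N Q * K `^ (nu Q / 2).
    rewrite /K -powRrM mulrA divfK ?gt_eqF// divff// powRr1 ?divr_ge0 ?ltW//.
    by rewrite mulrCA divff ?mulr1// gt_eqF.
  rewrite eK; apply: filterS2 (H K K0) (point_dist_le (ltW K0)) => n [_ gn] /(_ gn).
  by rewrite [X in _ -> _ <= _ * X]ger0_norm ?powR_ge0.
Qed.

End pathwise.

Theorem corollary2p3 (R : realType) (d : nat)
    (disp : measure_display) (Omega : measurableType disp)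
    (P : probability Omega R)
    (f : 'rV[R]_d -> R)
    (f_diff : forall x, differentiable f x)
    (grad_lip : locally_lipschitz (grad f))
    (alpha : nat -> R)
    (alpha_gt0 : forall n, 0 < alpha n)
    (theta : nat -> Omega -> 'rV[R]_d)
    (w : nat -> Omega -> 'rV[R]_d)
    (theta0_rv : random_vector (theta 0%N))
    (w_rv : forall n, random_vector (w n))
    (recursion : forall n om, theta n.+1 om =
       theta n om - alpha n *: (grad f (theta n om) + w n om))
    (alpha_cvg0 : alpha n @[n --> \oo] --> 0)
    (alpha_sum : (\sum_(0 <= n <oo) (alpha n)%:E)%E = +oo%E)
    (r : R) (r_gt0 : 0 < r)
    (w_limsup : {ae P, forall om, bounded_seq (theta ^~ om) ->
       (noise_limsup alpha r (w ^~ om) < +oo)%E})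
    (delta mu M : set 'rV[R]_d -> R -> R)
    (value_ineq : forall (Q : set 'rV[R]_d) (a : R),
       compact Q -> (f @` Q) a ->
       [/\ 0 < delta Q a < 1, 1 < mu Q a <= 2, 1 <= M Q a &
         forall x, Q x -> `|f x - a| <= delta Q a ->
           `|f x - a| <= M Q a * enorm (grad f x) `^ mu Q a])
    (nu N : set 'rV[R]_d -> R)
    (dist_ineq : forall Q : set 'rV[R]_d, compact Q ->
       [/\ 0 < nu Q <= 1, 1 <= N Q &
         forall x, Q x -> (setdist (@enorm R d) (crit_points f) x <=
           (N Q * enorm (grad f x) `^ nu Q)%:E)%E])
    (rho : Omega -> R) (rho_gt0 : forall om, 0 < rho om) :
  let Lambda := [set om | bounded_seq (theta ^~ om)] in
  let rhat om := r_hat f (theta ^~ om) (rho om) mu in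
  let phat om := p_hat f (theta ^~ om) (rho om) mu r in
  let qhat om := q_hat f (theta ^~ om) (rho om) mu nu r in
  let E := [set om | noise_limsup alpha r (w ^~ om) = 0%E /\
                     (r%:E < rhat om)%E] in
  {ae P, forall om, (Lambda `&` E) om ->
    [/\ (fun n => enorm (grad f (theta n om)) ^+ 2)
          =o_\oo (fun n => gam alpha n `^ (- phat om)),
        (fun n => fine (setdist Num.norm (crit_values f) (f (theta n om))))
          =o_\oo (fun n => gam alpha n `^ (- phat om)) &
        (fun n => fine (setdist (@enorm R d) (crit_points f) (theta n om)))
          =o_\oo (fun n => gam alpha n `^ (- qhat om))]} /\
  {ae P, forall om, (Lambda `&` ~` E) om ->
    [/\ (fun n => enorm (grad f (theta n om)) ^+ 2)
          =O_\oo (fun n => gam alpha n `^ (- phat om)),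
        (fun n => fine (setdist Num.norm (crit_values f) (f (theta n om))))
          =O_\oo (fun n => gam alpha n `^ (- phat om)) &
        (fun n => fine (setdist (@enorm R d) (crit_points f) (theta n om)))
          =O_\oo (fun n => gam alpha n `^ (- qhat om))]}.
Proof.
move=> Lambda rhat phat qhat E; split.
- apply: filterS w_limsup => om noise_fin [bounded [noise0 rr]].
  exact: (pathwise_littleo (x := theta ^~ om) (v := w ^~ om) f_diff grad_lip
    alpha_gt0 alpha_cvg0 alpha_sum (fun n => recursion n om) r_gt0
    (noise_fin bounded) bounded value_ineq dist_ineq (rho_gt0 om) noise0 rr).
- apply: filterS w_limsup => om noise_fin [bounded _].
  exact: (pathwise_bigO (x := theta ^~ om) (v := w ^~ om) f_diff grad_lip
    alpha_gt0 alpha_cvg0 alpha_sum (fun n => recursion n om) r_gt0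
    (noise_fin bounded) bounded value_ineq dist_ineq (rho_gt0 om)).
Qed.
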